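(* Let $\mathbb{K}$ be an algebraically closed field of characteristic zero. Let $a,b$ be integers with $b>a\geq 0$ such that $(a,b)$ is a primitive vector of $\mathbb{Z}^2$ (i.e. $\gcd(a,b)=1$), and let $X$ be the non-degenerate affine toric surface over $\mathbb{K}$ corresponding to the cone $\sigma\subset N_{\mathbb{Q}}=\mathbb{Q}^2$ generated by $v_1=(0,1)$ and $v_2=(b,-a)$, i.e. $X=\mathrm{Spec}(\mathbb{K}[\sigma^\vee\cap\mathbb{Z}^2])$ where $\sigma^\vee$ is the cone generated by $(1,0)$ and $(a,b)$. Then the group $\mathrm{Aut}(X)$ is connected if and only if one of the following three conditions holds: (1) $a=1$; (2) $b=1$; (3) $a^2\not\equiv 1\pmod b$. Moreover, if $\mathrm{Aut}(X)$ is not connected, then $$\mathrm{Aut}(X)/\mathrm{Aut}(X)^0\simeq\mathbb{Z}/2\mathbb{Z}.$$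
   Context: $\mathrm{Aut}(X)$ is the group of regular automorphisms of $X$. For an irreducible affine algebraic variety $S$, a map $S\to\mathrm{Aut}(X)$, $s\mapsto\phi_s$, is called an algebraic family if $S\times X\to X$, $(s,x)\mapsto\phi_s(x)$, is a morphism of algebraic varieties. $\mathrm{Aut}(X)$ is called connected if for every $g\in\mathrm{Aut}(X)$ there is an algebraic family in $\mathrm{Aut}(X)$ containing both $g$ and the identity automorphism. The neutral component $\mathrm{Aut}(X)^0$ is the subgroup of $\mathrm{Aut}(X)$ generated by the elements of all algebraic families containing the identity automorphism. A toric variety is non-degenerate if its only invertible regular functions are constants. (Every non-degenerate affine toric surface is of the form described in the claim for a suitable choice of lattice basis.) *)

(* Defs.v *)
From HB Require Import structures.
From mathcomp Require Import all_boot all_order all_algebra.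
From mathcomp Require Import boolp classical_sets.
From mathcomp Require monalg.
From mathcomp Require Import mpoly.
From mathcomp Require Import ring lra.

Set Implicit Arguments.
Unset Strict Implicit.
Unset Printing Implicit Defensive.

Import Order.TTheory GRing.Theory Num.Theory.
Local Open Scope ring_scope.

(* Varieties as spaces with functions: a set of closed points together with
   its K-valued regular functions. *)
Record fun_space (K : closedFieldType) := FunSpace {
  point :> Type;
  regular : set (point -> K) }.

Section Varieties.
Variable K : closedFieldType.
Implicit Types V W X S : fun_space K.

(* V is isomorphic, as a space with functions, to a Zariski-closed subset of
   the affine space K^n with the restrictions of polynomials; v |-> (x i v)_i
   is the closed embedding. *)
Definition affine V : Prop :=
  exists (n : nat) (x : 'I_n -> V -> K),
    [/\ forall f : V -> K, regular f <->
          exists p : {mpoly K[n]}, forall v, f v = p.@[fun i => x i v],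
        forall v w : V, (forall i, x i v = x i w) -> v = w &
        exists E : set {mpoly K[n]}, forall y : 'I_n -> K,
          (exists v : V, forall i, x i v = y i) <->
          (forall p, E p -> p.@[y] = 0)].

Definition zariski_closed V (Z : set V) : Prop :=
  exists2 E : set (V -> K), (forall f, E f -> regular f) &
    forall v, Z v <-> (forall f, E f -> f v = 0).

Definition irreducible V : Prop :=
  (exists v : V, True) /\
  forall Z1 Z2 : set V, zariski_closed Z1 -> zariski_closed Z2 ->
    (forall v, Z1 v \/ Z2 v) -> (forall v, Z1 v) \/ (forall v, Z2 v).

Definition regular_morphism V W (f : V -> W) : Prop :=
  forall h : W -> K, regular h -> regular (fun v => h (f v)).

(* The coordinate ring of a product of affine varieties is the tensor product
   of the coordinate rings. *)
Definition product V W : fun_space K :=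
  @FunSpace K (V * W)%type (fun F =>
    exists (n : nat) (f : 'I_n -> V -> K) (g : 'I_n -> W -> K),
      [/\ forall i, regular (f i), forall i, regular (g i) &
          forall z, F z = \sum_(i < n) f i z.1 * g i z.2]).

(* Closed points of Spec A are the K-algebra morphisms A -> K (Nullstellensatz,
   for A finitely generated). *)
Definition Spec (A : comAlgType K) : fun_space K :=
  @FunSpace K {lrmorphism A -> K | *%R} (fun f =>
    exists c : A, forall x : {lrmorphism A -> K | *%R}, f x = x c).

Record automorphism X := Automorphism {
  aut_fun :> X -> X;
  aut_inv : X -> X;
  aut_funK : cancel aut_fun aut_inv;
  aut_invK : cancel aut_inv aut_fun;
  aut_fun_morph : regular_morphism aut_fun;
  aut_inv_morph : regular_morphism aut_inv }.

End Varieties.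

Section AutGroup.
Variables (K : closedFieldType) (X : fun_space K).
Implicit Types g h : automorphism X.

HB.instance Definition _ := gen_eqMixin (automorphism X).
HB.instance Definition _ := gen_choiceMixin (automorphism X).

Lemma autP g h : g =1 h -> g = h.
Proof.
case: g h => [f f' fK f'K mf mf'] [k k' kK k'K mk mk'] /= /funext fk.
subst k; have e : f' = k' by apply/funext => x; rewrite -{1}(k'K x) fK.
by subst k'; congr Automorphism; apply: Prop_irrelevance.
Qed.

Definition aut_id : automorphism X :=
  @Automorphism K X id id (fun=> erefl) (fun=> erefl)
    (fun f rf => rf) (fun f rf => rf).

Definition aut_opp g : automorphism X :=
  Automorphism (@aut_invK _ _ g) (@aut_funK _ _ g)
    (@aut_inv_morph _ _ g) (@aut_fun_morph _ _ g).

Definition aut_comp g h : automorphism X :=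
  @Automorphism K X (fun x => g (h x)) (fun x => aut_inv h (aut_inv g x))
    (can_comp (@aut_funK _ _ g) (@aut_funK _ _ h))
    (can_comp (@aut_invK _ _ h) (@aut_invK _ _ g))
    (fun f rf => aut_fun_morph h (aut_fun_morph g rf))
    (fun f rf => aut_inv_morph g (aut_inv_morph h rf)).

Fact aut_compA : associative aut_comp.
Proof. by move=> g h k; apply: autP. Qed.
Fact aut_comp1g : left_id aut_id aut_comp.
Proof. by move=> g; apply: autP. Qed.
Fact aut_compg1 : right_id aut_id aut_comp.
Proof. by move=> g; apply: autP. Qed.
Fact aut_compVg : left_inverse aut_id aut_opp aut_comp.
Proof. by move=> g; apply: autP => x /=; rewrite aut_funK. Qed.
Fact aut_compgV : right_inverse aut_id aut_opp aut_comp.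
Proof. by move=> g; apply: autP => x /=; rewrite aut_invK. Qed.

HB.instance Definition _ := isGroup.Build (automorphism X)
  aut_compA aut_comp1g aut_compg1 aut_compVg aut_compgV.

End AutGroup.

Definition Aut (K : closedFieldType) (X : fun_space K) : groupType :=
  automorphism X.

Section Groups.
Local Open Scope group_scope.
Variable G : groupType.

Definition is_subgroup (H : set G) : Prop :=
  [/\ H 1, forall g h, H g -> H h -> H (g * h) & forall g, H g -> H g^-1].

Definition is_normal (N : set G) : Prop :=
  is_subgroup N /\ forall g n, N n -> N (g * n * g^-1).

Definition generated_subgroup (E : set G) : set G := smallest is_subgroup E.

Definition left_coset (N : set G) (g : G) : set G :=
  [set h | exists2 n, N n & h = g * n]%classic.

(* phi, restricted to the cosets, is a group isomorphism G / N -> H. *)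
Definition quotient_isog (N : set G) (H : groupType) : Prop :=
  is_normal N /\
  exists phi : set G -> H,
    [/\ forall g h, phi (left_coset N (g * h)) =
                    phi (left_coset N g) * phi (left_coset N h),
        forall g h, phi (left_coset N g) = phi (left_coset N h) ->
                    left_coset N g = left_coset N h &
        forall z, exists g, phi (left_coset N g) = z].

End Groups.

Section Families.
Variables (K : closedFieldType) (X : fun_space K).

Definition algebraic_family (S : fun_space K) (phi : S -> Aut X) : Prop :=
  [/\ affine S, irreducible S &
      @regular_morphism K (product S X) X (fun z => phi z.1 z.2)].

Definition in_family_with_identity (g : Aut X) : Prop :=
  exists (S : fun_space K) (phi : S -> Aut X),
    [/\ algebraic_family phi, exists s, phi s = g &
        exists s, phi s = 1%g].

Definition Aut_connected : Prop := forall g : Aut X, in_family_with_identity g.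

Definition Aut0 : set (Aut X) := generated_subgroup in_family_with_identity.

End Families.

Import monalg.

Section ToricSurface.

Definition pairing (m v : int * int) : int := m.1 * v.1 + m.2 * v.2.

(* Lattice points of the dual of the cone generated by vs. *)
Definition dual_cone (vs : seq (int * int)) (m : int * int) : bool :=
  all (fun v => 0 <= pairing m v) vs.

Definition cone_generators (a b : int) : seq (int * int) :=
  [:: (0, 1); (b, - a)].

Lemma dual_coneP (a b : int) (b_gt0 : 0 < b) (m : int * int) :
  dual_cone (cone_generators a b) m <->
  exists s t : rat, [/\ 0 <= s, 0 <= t,
    m.1%:~R = s * 1 + t * a%:~R & m.2%:~R = s * 0 + t * b%:~R].
Proof.
have bQ : 0 < b%:~R :> rat by rewrite ltr0z.
rewrite /dual_cone /pairing /= andbT; split.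
  case/andP; rewrite mulr0 mulr1 add0r => m2 m12.
  exists (m.1%:~R - m.2%:~R / b%:~R * a%:~R), (m.2%:~R / b%:~R).
  split.
  - rewrite -(pmulr_lge0 _ bQ).
    have -> : (m.1%:~R - m.2%:~R / b%:~R * a%:~R) * b%:~R
       = (m.1 * b + m.2 * - a)%:~R :> rat.
      by rewrite rmorphD !rmorphM rmorphN /=; field; rewrite gt_eqF.
    by rewrite ler0z.
  - by rewrite divr_ge0 ?ler0z // ltW.
  - by rewrite mulr1 subrK.
  - by rewrite mulr0 add0r divfK // gt_eqF.
case=> s [t [s0 t0 e1 e2]]; apply/andP; split.
  by rewrite mulr0 mulr1 add0r -(ler0z rat) e2 mulr0 add0r mulr_ge0 // ltW.
rewrite -(ler0z rat) rmorphD !rmorphM rmorphN /= e1 e2.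
have -> : (s * 1 + t * a%:~R) * b%:~R + (s * 0 + t * b%:~R) * - a%:~R
   = s * b%:~R :> rat by ring.
by rewrite mulr_ge0 // ltW.
Qed.

(* The semigroup of lattice points of the dual cone; b_gt0 makes this cone
   strictly convex, which the monomial structure below requires. *)
Record toric_semigroup (a b : int) (b_gt0 : 0 < b) := ToricSemigroup {
  lattice_point : int * int;
  _ : dual_cone (cone_generators a b) lattice_point }.

Variables (a b : int) (b_gt0 : 0 < b).
Local Notation M := (toric_semigroup a b_gt0).

HB.instance Definition _ := [isSub for @lattice_point a b b_gt0].
HB.instance Definition _ := [Choice of M by <:].

Fact toric_one_subproof : dual_cone (cone_generators a b) 0.
Proof. by rewrite /dual_cone /pairing /= !mul0r addr0 lexx. Qed.

Definition toric_one : M := ToricSemigroup b_gt0 toric_one_subproof.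

Fact toric_mul_subproof (m n : M) :
  dual_cone (cone_generators a b) (lattice_point m + lattice_point n).
Proof.
case: m n => [m hm] [n hn]; move: hm hn; rewrite /dual_cone /pairing /=.
by move=> /and3P[m1 m2 _] /and3P[n1 n2 _]; apply/and3P; split=> //; lra.
Qed.

Definition toric_mul (m n : M) : M :=
  ToricSemigroup b_gt0 (toric_mul_subproof m n).

Fact toric_mulA : associative toric_mul.
Proof. by move=> x y z; apply: val_inj; rewrite /= addrA. Qed.
Fact toric_mul1m : left_id toric_one toric_mul.
Proof. by move=> x; apply: val_inj; rewrite /= add0r. Qed.
Fact toric_mulm1 : right_id toric_one toric_mul.
Proof. by move=> x; apply: val_inj; rewrite /= addr0. Qed.
Fact toric_mulC : commutative toric_mul.
Proof. by move=> x y; apply: val_inj; rewrite /= addrC. Qed.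
Fact toric_unitm (x y : M) :
  toric_mul x y = toric_one -> x = toric_one /\ y = toric_one.
Proof.
case: x y => [[x1 x2] hx] [[y1 y2] hy] /(congr1 val) /= [e1 e2].
have [/= px py] := (hx, hy); rewrite /dual_cone /pairing /= in px py.
case/and3P: px => p1 p2 _; case/and3P: py => q1 q2 _.
have x20 : x2 = 0 by lra.
have y20 : y2 = 0 by lra.
have b0 : b != 0 by rewrite gt_eqF.
have x10 : x1 = 0.
  apply/eqP; rewrite -(mulIr_eq0 _ (mulIf b0)); apply/eqP.
  have -> : x1 = - y1 by lra.
  subst; nra.
have y10 : y1 = 0 by lra.
by split; apply: val_inj => /=; rewrite ?x10 ?x20 ?y10 ?y20.
Qed.

HB.instance Definition _ := Choice_isMonomialDef.Build M
  toric_mulA toric_mul1m toric_mulm1 toric_unitm.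
HB.instance Definition _ := MonomialDef_isConomialDef.Build M toric_mulC.

Definition semigroup_algebra (K : closedFieldType) : comAlgType K :=
  {malg K[M]}.

Definition toric_surface (K : closedFieldType) : fun_space K :=
  Spec (semigroup_algebra K).

End ToricSurface.

(* Main.v *)
Require Import Defs.
From HB Require Import structures.
From mathcomp Require Import all_boot all_order all_algebra.
From mathcomp Require Import boolp classical_sets.
From mathcomp Require monalg.
From mathcomp Require Import ssrcomplements mpoly.
From mathcomp Require Import ring lra zify.

(* The exponents (p, q) of the monomials of the coordinate ring A are the
   pairings of the lattice points of the dual cone with (0, 1) and (b, -a);
   this identifies A with the subring of K[x, y] spanned by the x^p y^q with
   q + a p = 0 mod b, i.e. with the invariants of mu_b acting with weights
   (a, 1).

   Differential operators give the degree filtration of A an intrinsic meaning: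
   f lies in (x, y)^d iff every operator of order < d sends f into the maximal
   ideal m of the vertex.  If b > 1 no derivation of A has a component of
   negative degree, so the vertex is the only point whose ideal is stable under
   all derivations; hence automorphisms fix it (if b = 1, translate) and
   preserve the filtration.  Conjugation by (x, y) |-> (t x, t y) then extends
   to t = 0 and connects every automorphism to a graded one.

   If a = 1 or b = 1, then A is a Veronese subring of K[x, y] and its graded
   automorphisms come from GL_2.  Otherwise the degree 1 + b - a, where every
   monomial is divisible by both x and y, forces a graded automorphism to send
   monomials to monomials; so it is diagonal, or a diagonal one composed with
   the exchange of x and y, which preserves A iff a^2 = 1 mod b.  Diagonal ones
   are connected to the identity inside the torus.  In a family phi_s over an
   irreducible base, the coefficients of phi_s^*(x^b) at x^b and y^b are regular
   functions of s exactly one of which vanishes at each s, so the two types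
   cannot mix. *)

Set Implicit Arguments.
Unset Strict Implicit.
Unset Printing Implicit Defensive.

Import Order.TTheory GRing.Theory Num.Theory.
Local Open Scope ring_scope.

(** * Polynomial functions and finite differences *)

Section PolynomialFunctions.
Variable K : fieldType.
Implicit Types (C : K -> K -> K) (c : nat -> nat -> K).

(* Functions given by a polynomial of total degree < d. *)
Fixpoint polfun (d : nat) C : Prop :=
  if d is d'.+1 then
    exists C1 C2 k, [/\ polfun d' C1, polfun d' C2 &
      forall z w, C z w = z * C1 z w + w * C2 z w + k]
  else forall z w, C z w = 0.

Lemma polfun_ext d C C' : (forall z w, C z w = C' z w) ->
  polfun d C -> polfun d C'.
Proof.
case: d => [|d] e /=; first by move=> h z w; rewrite -e.
by case=> C1 [C2 [k [h1 h2 h]]]; exists C1, C2, k; split=> // z w; rewrite -e.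
Qed.

Lemma polfunD d C C' : polfun d C -> polfun d C' ->
  polfun d (fun z w => C z w + C' z w).
Proof.
elim: d C C' => [|d IH] C C' /= ; first by move=> h h' z w; rewrite h h' addr0.
case=> [C1 [C2 [k [h1 h2 h]]]] [C1' [C2' [k' [h1' h2' h']]]].
exists (fun z w => C1 z w + C1' z w), (fun z w => C2 z w + C2' z w), (k + k').
by split; [exact: IH | exact: IH | move=> z w; rewrite h h'; ring].
Qed.

Lemma polfun0 d : polfun d (fun _ _ => 0).
Proof.
elim: d => //= d IH; exists (fun _ _ => 0), (fun _ _ => 0), 0.
by split=> // z w; rewrite !mulr0 !addr0.
Qed.

Lemma polfunZ d a C : polfun d C -> polfun d (fun z w => a * C z w).
Proof.
elim: d C => [|d IH] C /=; first by move=> h z w; rewrite h mulr0.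
case=> [C1 [C2 [k [h1 h2 h]]]].
exists (fun z w => a * C1 z w), (fun z w => a * C2 z w), (a * k).
by split; [exact: IH | exact: IH | move=> z w; rewrite h; ring].
Qed.

Lemma polfunS d C : polfun d C -> polfun d.+1 C.
Proof.
elim: d C => [|d IH] C.
  move=> h; exists (fun _ _ => 0), (fun _ _ => 0), 0.
  by split=> // z w; rewrite h !mulr0 !addr0.
case=> [C1 [C2 [k [h1 h2 h]]]]; exists C1, C2, k.
by split=> //; apply: IH.
Qed.

Lemma polfunW d d' C : (d <= d')%N -> polfun d C -> polfun d' C.
Proof.
move=> /subnK <-; elim: (d' - d)%N => // n IH h.
by rewrite addSn; apply: polfunS; apply: IH.
Qed.

Lemma polfunX1 d C : polfun d C -> polfun d.+1 (fun z w => z * C z w).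
Proof.
move=> h; exists C, (fun _ _ => 0), 0; split=> //; first exact: polfun0.
by move=> z w; rewrite mulr0 !addr0.
Qed.

Lemma polfunX2 d C : polfun d C -> polfun d.+1 (fun z w => w * C z w).
Proof.
move=> h; exists (fun _ _ => 0), C, 0; split=> //; first exact: polfun0.
by move=> z w; rewrite mulr0 add0r !addr0.
Qed.

Lemma polfun_aff d x y e C : polfun d C ->
  polfun d.+1 (fun z w => (x * z + y * w + e) * C z w).
Proof.
move=> h; apply: (@polfun_ext _ (fun z w =>
   x * (z * C z w) + y * (w * C z w) + e * C z w)) => [z w|]; first by ring.
apply: polfunD; last by apply: polfunZ; apply: polfunS.
by apply: polfunD; apply: polfunZ; [exact: polfunX1 | exact: polfunX2].
Qed.

Lemma polfun_shift d C e f : polfun d C ->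
  polfun d (fun z w => C (z + e) (w + f)).
Proof.
elim: d C => [|d IH] C /=; first by move=> h z w; apply: h.
case=> [C1 [C2 [k [h1 h2 h]]]].
apply: (@polfun_ext d.+1 (fun z w =>
   ((1 * z + 0 * w + e) * C1 (z + e) (w + f) +
    (0 * z + 1 * w + f) * C2 (z + e) (w + f)) + k)) => [z w|].
  by rewrite h; ring.
apply: polfunD; last first.
  exists (fun _ _ => 0), (fun _ _ => 0), k.
  by split; rewrite ?mulr0; try exact: polfun0; move=> *; rewrite !mulr0 !add0r.
by apply: polfunD; apply: polfun_aff; apply: IH.
Qed.

Lemma polfun_diff d C e f : polfun d.+1 C ->
  polfun d (fun z w => C (z + e) (w + f) - C z w).
Proof.
elim: d C => [|d IH] C.
  by case=> [C1 [C2 [k [h1 h2 h]]]] z w; rewrite !h !h1 !h2; ring.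
case=> [C1 [C2 [k [h1 h2 h]]]].
apply: (@polfun_ext _ (fun z w =>
   (z * (C1 (z + e) (w + f) - C1 z w) + e * C1 (z + e) (w + f)) +
   (w * (C2 (z + e) (w + f) - C2 z w) + f * C2 (z + e) (w + f)))) => [z w|].
  by rewrite !h; ring.
apply: polfunD; apply: polfunD.
- by apply: polfunX1; apply: IH.
- by apply: polfunZ; apply: polfun_shift.
- by apply: polfunX2; apply: IH.
- by apply: polfunZ; apply: polfun_shift.
Qed.

Lemma polfun_line d C z0 z1 w0 w1 : polfun d C ->
  exists P : {poly K}, forall t, C (z0 + t * z1) (w0 + t * w1) = P.[t].
Proof.
elim: d C => [|d IH] C /=; first by move=> h; exists 0 => t; rewrite h horner0.
case=> [C1 [C2 [k [/IH[P1 h1] /IH[P2 h2] h]]]].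
exists ((z0%:P + 'X * z1%:P) * P1 + (w0%:P + 'X * w1%:P) * P2 + k%:P) => t.
by rewrite h h1 h2 !hornerE.
Qed.

(** The binomial coefficient [z] over [k] as a polynomial in [z], the basis in which Newton's
    formula is written. *)
Definition binomK (k : nat) (z : K) : K :=
  (\prod_(i < k) (z - i%:R)) / (k`!)%:R.

Lemma polfun_binom d k x y e C : polfun d C ->
  polfun (k + d) (fun z w => binomK k (x * z + y * w + e) * C z w).
Proof.
move=> h; apply: (@polfun_ext _ (fun z w =>
   (k`!)%:R^-1 * ((\prod_(i < k) ((x * z + y * w + e) - i%:R)) * C z w))).
  by move=> z w; rewrite /binomK; ring.
apply: polfunZ; elim: k => [|k IH].
  by rewrite add0n; apply: polfun_ext h => z w; rewrite big_ord0 mul1r.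
apply: (@polfun_ext _ (fun z w => (x * z + y * w + (e - k%:R)) *
   ((\prod_(i < k) ((x * z + y * w + e) - i%:R)) * C z w))) => [z w|].
  by rewrite big_ord_recr /=; ring.
by rewrite addSn; apply: polfun_aff.
Qed.

Lemma polfun_sum d n (F : 'I_n -> K -> K -> K) :
  (forall i, polfun d (F i)) -> polfun d (fun z w => \sum_i F i z w).
Proof.
elim: n F => [|n IH] F hF.
  by apply: polfun_ext (polfun0 d) => z w; rewrite big_ord0.
apply: (@polfun_ext _ (fun z w => F ord0 z w +
   \sum_(i < n) F (lift ord0 i) z w)) => [z w|]; first by rewrite big_ord_recl.
by apply: polfunD => //; apply: IH.
Qed.

Hypothesis char0 : forall n, n.+1%:R != 0 :> K.

Lemma natr_inj_char0 (m n : nat) : m%:R = n%:R :> K -> m = n.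
Proof.
wlog lemn : m n / (m <= n)%N => [H|].
  by case: (leqP m n) => [/H//|/ltnW/H + /esym] => /[apply].
move=> /eqP; rewrite eq_sym -subr_eq0 -natrB // => /eqP e.
apply/eqP; rewrite eqn_leq lemn -subn_eq0.
by case: (n - m)%N e => // k /eqP; rewrite (negbTE (char0 _)).
Qed.

Lemma binomK_nat k n : binomK k n%:R = 'C(n, k)%:R.
Proof.
have fk : (k`!)%:R != 0 :> K by rewrite -(prednK (fact_gt0 k)).
apply: (mulIf fk); rewrite /binomK divfK // -natrM bin_ffact.
elim: k {fk} => [|k IH]; first by rewrite big_ord0 ffactn0.
rewrite big_ord_recr /= IH ffactnSr natrM; case: (leqP k n) => [h|h].
  by rewrite natrB.
by rewrite ffact_small // !mul0r.
Qed.

Lemma poly_eq0_nat (P : {poly K}) (J : nat) :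
  (forall j, (J <= j)%N -> P.[j%:R] = 0) -> P = 0.
Proof.
move=> h; apply/eqP; apply: contraT => P0.
have := max_poly_roots (rs := [seq (i : nat)%:R | i <- iota J (size P)]) P0.
rewrite size_map size_iota ltnn; apply.
  apply/allP => _ /mapP[i + ->]; rewrite mem_iota => /andP[+ _].
  by move=> /h /eqP.
by rewrite map_inj_in_uniq ?iota_uniq // => i j _ _ /natr_inj_char0.
Qed.

(** A nonzero polynomial vanishing on the first [p0] columns and the first [q0] rows would be
    divisible by [p0] linear forms in [z] and [q0] in [w], contrary to its degree. The induction
    takes a difference across a family of lines, which lowers the degree and the number of lines by
    one each. *)
Lemma polfun_vanish d C p0 q0 : polfun d C -> (d <= p0 + q0)%N ->
  (forall k l : nat, (k < p0)%N || (l < q0)%N -> C k%:R l%:R = 0) ->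
  forall k l : nat, C k%:R l%:R = 0.
Proof.
elim: d C p0 q0 => [|d IH] C p0 q0 pC; first by move=> _ _ k l; apply: pC.
case: p0 => [|p0] le_d van.
  case: q0 le_d van => [//|q0] le_d van.
  have van' k l : C k%:R l.+1%:R - C k%:R l%:R = 0.
    rewrite -natr1 -{1}(addr0 k%:R).
    apply: (IH _ 0%N q0 (polfun_diff 0 1 pC)) => [|k' l' /= ll']; first by lia.
    by rewrite addr0 natr1 !van ?subrr //; lia.
  move=> k; elim=> [|l IHl]; first by apply: van; lia.
  by apply/eqP; rewrite -IHl -subr_eq0 van'.
have van' k l : C k.+1%:R l%:R - C k%:R l%:R = 0.
  rewrite -natr1 -{1}(addr0 l%:R).
  apply: (IH _ p0 q0 (polfun_diff 1 0 pC)) => [|k' l' /= ll']; first by lia.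
  by rewrite addr0 natr1 !van ?subrr //; lia.
move=> k l; elim: k => [|k IHk]; first by apply: van; lia.
by apply/eqP; rewrite -IHk -subr_eq0 van'.
Qed.

Definition fdiff (s t : nat) c : nat -> nat -> K :=
  fun p q => c (s + p)%N (t + q)%N - c p q.

(** Newton's forward difference formula along the step [(s, t)]. The length [N] of the sum is free,
    since the binomials vanish beyond [n]; sums for different [n] can thus share one range. *)
Lemma newton s t c n N p q : (n < N)%N ->
  c (s * n + p)%N (t * n + q)%N =
  \sum_(k < N) 'C(n, k)%:R * iter k (fdiff s t) c p q.
Proof.
elim: n c N => [|n IH] c [|N] // nN.
  rewrite big_ord_recl big1 => [|i _]; last by rewrite bin0n mul0r.
  by rewrite !muln0 !add0n bin0 mul1r addr0.
have -> : c (s * n.+1 + p)%N (t * n.+1 + q)%N =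
    c (s * n + p)%N (t * n + q)%N + fdiff s t c (s * n + p)%N (t * n + q)%N.
  by rewrite /fdiff !mulnS !addnA addrC subrK.
rewrite (IH c N.+1) 1?ltnW // (IH (fdiff s t c) N) //.
rewrite !big_ord_recl !bin0 -addrA; congr (_ + _).
rewrite -big_split; apply: eq_bigr => i _ /=.
by rewrite binS natrD mulrDl -iterSr.
Qed.

Variables (na nb : nat).
Hypothesis nb_gt0 : (0 < nb)%N.

(* The exponents of the mu_nb-invariant monomials, x and y having weights na
   and 1. *)
Definition in_cone (p q : nat) : bool := (nb %| q + na * p)%N.

(** Degree [< d] on the semigroup alone, by iterated differences with steps in it. The recursion
    runs parallel to that of [diffop]: a commutator with a monomial becomes a difference. *)
Fixpoint pol_on (d : nat) c : Prop :=
  if d is d'.+1 then forall s t, in_cone s t -> pol_on d' (fdiff s t c)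
  else forall p q, in_cone p q -> c p q = 0.

Lemma in_coneD p q s t : in_cone p q -> in_cone s t -> in_cone (s + p) (t + q).
Proof.
by rewrite /in_cone => h h'; rewrite mulnDr addnACA dvdn_add.
Qed.

Lemma pol_on_ext d c c' : (forall p q, in_cone p q -> c p q = c' p q) ->
  pol_on d c -> pol_on d c'.
Proof.
elim: d c c' => [|d IH] c c' e /= h; first by move=> p q Sp; rewrite -e ?h.
move=> s t Ss; apply: IH (h s t Ss) => p q Sp.
by rewrite /fdiff !e // in_coneD.
Qed.

Lemma pol_on_iter d c k s t : in_cone s t -> pol_on d c ->
  pol_on (d - k) (iter k (fdiff s t) c).
Proof.
move=> hs; elim: k => [|k IH] h; first by rewrite subn0.
rewrite subnS iterS; have := IH h; case: (d - k)%N => [|e] /=; last by apply.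
by move=> h0 p q hpq; rewrite /fdiff !h0 ?subr0 //; apply: in_coneD.
Qed.

Hypothesis na_le : (na <= nb)%N.
Let q1 := (nb - na)%N.

Lemma in_cone_1 : in_cone 1 q1. Proof. by rewrite /in_cone muln1 subnK. Qed.
Lemma in_cone_0b : in_cone 0 nb. Proof. by rewrite /in_cone muln0 addn0. Qed.
Lemma in_cone_b0 : in_cone nb 0. Proof. by rewrite /in_cone add0n dvdn_mull. Qed.
Lemma in_cone_00 : in_cone 0 0. Proof. by rewrite /in_cone muln0 dvdn0. Qed.

(* Newton's formula on the subsemigroup generated by (1, q1) and (0, nb). *)
Lemma pol_on_subcone d c : pol_on d c ->
  exists2 C, polfun d C & forall i j,
    c i (q1 * i + nb * j)%N = C i%:R (q1 * i + nb * j)%N%:R.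
Proof.
move=> hc.
pose D k l := iter k (fdiff 1 q1) (iter l (fdiff 0 nb) c) 0%N 0%N.
(* At the point [(i, q1 * i + nb * j)] the arguments of the two binomials are [i] and [j]. *)
pose C z w := \sum_(k < d) \sum_(l < d)
  (binomK k (1 * z + 0 * w + 0) *
    (binomK l (- (q1%:R / nb%:R) * z + nb%:R^-1 * w + 0) * D k l)).
have D0 k l : (d <= k + l)%N -> D k l = 0.
  move=> h; have /(pol_on_iter l in_cone_0b)/(pol_on_iter k in_cone_1) := hc.
  have -> : (d - l - k = 0)%N by lia.
  by apply; apply: in_cone_00.
exists C.
  apply: polfun_sum => k; apply: polfun_sum => l.
  case: (leqP d (k + l)) => h.
    by apply: polfun_ext (polfun0 d) => z w; rewrite D0 // !mulr0.
  apply: (@polfunW (k + (l + 1))); first by lia.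
  do 2!apply: polfun_binom; exists (fun _ _ => 0), (fun _ _ => 0), (D k l).
  by split=> // z w; rewrite !mulr0 !add0r.
(* [N] exceeds [i], [j] and [d - 1], so both Newton expansions hold with this length and can
   afterwards be cut down to [d] terms by [D0]. *)
move=> i j; pose N := (maxn d (maxn i j).+1)%N.
have -> : c i (q1 * i + nb * j)%N =
   \sum_(k < N) \sum_(l < N) 'C(i, k)%:R * ('C(j, l)%:R * D k l).
  have := newton 0 nb c i (q1 * i)%N (_ : j < N)%N.
  rewrite mul0n add0n addnC => ->; last by rewrite /N; lia.
  rewrite exchange_big; apply: eq_bigr => l _ /=.
  have := newton 1 q1 (iter l (fdiff 0 nb) c) 0 0 (_ : i < N)%N.
  rewrite mul1n !addn0 => ->; last by rewrite /N; lia.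
  by rewrite mulr_sumr; apply: eq_bigr => k _; rewrite /D; ring.
have nb0 : nb%:R != 0 :> K by rewrite -(prednK nb_gt0).
have Ni (F : nat -> K) : (forall k, (d <= k)%N -> F k = 0) ->
    \sum_(k < N) F k = \sum_(k < d) F k.
  move=> h; rewrite [RHS](big_ord_widen N F) ?leq_maxl //.
  rewrite [LHS](bigID (fun k : 'I__ => (k < d)%N)) /= [X in _ + X]big1 ?addr0 //.
  by move=> k; rewrite -leqNgt => /h.
rewrite (Ni (fun k => \sum_(l < N) 'C(i, k)%:R * ('C(j, l)%:R * D k l))); last first.
  by move=> k hk; apply: big1 => l _; rewrite D0 ?mulr0 //; lia.
apply: eq_bigr => k _.
rewrite (Ni (fun l => 'C(i, k)%:R * ('C(j, l)%:R * D k l))); last first.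
  by move=> l hl; rewrite D0 ?mulr0 //; lia.
apply: eq_bigr => l _.
have -> : 1 * i%:R + 0 * (q1 * i + nb * j)%N%:R + 0 = i%:R :> K by ring.
have -> : - (q1%:R / nb%:R) * i%:R + nb%:R^-1 * (q1 * i + nb * j)%N%:R + 0
   = j%:R :> K by rewrite natrD !natrM; field.
by rewrite !binomK_nat.
Qed.

(** The cone contains points outside the subsemigroup of [pol_on_subcone]. Moving from such a point
    in the direction [(0, nb)] one eventually enters the subsemigroup; along this ray both [c] and
    [C] are polynomial in the number of steps and agree from some step on, hence agree at step 0. *)
Lemma pol_on_polfun d c : pol_on d c ->
  exists2 C, polfun d C & forall p q, in_cone p q -> c p q = C p%:R q%:R.
Proof.
move=> hc; have [C pC hC] := pol_on_subcone hc; exists C => // p q hpq.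
have [P hP] := polfun_line p%:R 0 q%:R nb%:R pC.
pose Q : {poly K} := \sum_(k < d) ((iter k (fdiff 0 nb) c p q / (k`!)%:R) *:
   \prod_(i < k) ('X - (i%:R)%:P)).
have hQ j : c p (nb * j + q)%N = Q.[j%:R].
  have := newton 0 nb c p q (_ : j < maxn d j.+1)%N.
  rewrite mul0n add0n => ->; last by rewrite leq_maxr.
  rewrite /Q horner_sum [RHS](big_ord_widen (maxn d j.+1)
    (fun k => (iter k (fdiff 0 nb) c p q / (k`!)%:R *:
      \prod_(i < k) ('X - (i%:R)%:P)).[j%:R])) ?leq_maxl //.
  rewrite [LHS](bigID (fun k : 'I__ => (k < d)%N)) /= [X in _ + X]big1 ?addr0.
    apply: eq_bigr => k _; rewrite hornerZ horner_prod -binomK_nat /binomK.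
    under [X in _ = _ * X]eq_bigr do rewrite hornerXsubC.
    by ring.
  move=> k; rewrite -leqNgt => kd.
  have := pol_on_iter k in_cone_0b hc; rewrite (_ : d - k = 0)%N; last by lia.
  by move=> ->//; rewrite mulr0.
have PQ : P - Q = 0.
  apply: (@poly_eq0_nat _ (q1 * p)) => j hj; rewrite hornerD hornerN -hQ -hP.
  rewrite mulr0 addr0 -natrM -natrD.
  have [j' ej'] : exists j', (nb * j + q = q1 * p + nb * j')%N.
    have h1 : (nb %| nb * j + q - q1 * p)%N.
      have : (nb %| (nb * j + q - q1 * p) + nb * p)%N.
        have -> : (nb * j + q - q1 * p + nb * p = nb * j + (q + na * p))%N.
          have : (q1 * p + na * p = nb * p)%N by rewrite -mulnDl subnK.
          have : (q1 * p <= nb * j)%N by rewrite (leq_trans hj) // leq_pmull.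
          by lia.
        by rewrite dvdn_add // dvdn_mulr.
      by rewrite dvdn_addl // dvdn_mulr.
    have /dvdnP[j' ej] := h1; exists j'.
    have : (q1 * p <= nb * j)%N by rewrite (leq_trans hj) // leq_pmull.
    by lia.
  by rewrite [(j * nb)%N]mulnC [(q + _)%N]addnC ej' hC subrr.
have := hQ 0%N; rewrite muln0 add0n => ->.
by move/eqP: PQ; rewrite subr_eq0 => /eqP <-; rewrite -hP !mul0r !addr0.
Qed.

(** The interpolating polynomial vanishes at the cone points of each column [k < p0] and each row
    [l < q0]. These are infinitely many, so it vanishes on the whole lines and [polfun_vanish]
    applies. *)
Lemma pol_on_vanish d c p0 q0 : coprime na nb ->
  pol_on d c -> (d <= p0 + q0)%N -> in_cone p0 q0 ->
  (forall p q, in_cone p q -> (p < p0)%N || (q < q0)%N -> c p q = 0) ->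
  c p0 q0 = 0.
Proof.
move=> cop hc le_d h0 van; have [C pC hC] := pol_on_polfun hc.
rewrite hC //; apply: (polfun_vanish pC le_d) => k l hkl.
have nb0 : nb%:R != 0 :> K by rewrite -(prednK nb_gt0).
case/orP: hkl => hkl.
  pose l0 := (q1 * k)%N.
  have [P hP] := polfun_line k%:R 0 l0%:R nb%:R pC.
  have P0 : P = 0.
    apply: (@poly_eq0_nat _ 0) => j _; rewrite -hP mulr0 addr0 -natrM -natrD.
    have hS : in_cone k (l0 + j * nb).
      rewrite /in_cone /l0 addnAC -mulnDl subnK //.
      by apply: dvdn_add; [exact: dvdn_mulr | exact: dvdn_mull].
    by rewrite -hC // van // hkl.
  have := hP ((l%:R - l0%:R) / nb%:R); rewrite P0 horner0 mulr0 addr0.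
  by rewrite divfK // addrC subrK.
(* A Bezout relation [u * nb - v * na = 1] provides a cone point on the row [l]. *)
have [k0 hk0] : exists k0, in_cone k0 l.
  have /coprimeP : coprime nb na by rewrite coprime_sym.
  case=> // -[u v] /= euv; exists (v * l)%N; rewrite /in_cone.
  have -> : (l + na * (v * l) = u * l * nb)%N by nia.
  by rewrite dvdn_mull.
have [P hP] := polfun_line k0%:R nb%:R l%:R 0 pC.
have P0 : P = 0.
  apply: (@poly_eq0_nat _ 0) => j _; rewrite -hP mulr0 addr0 -natrM -natrD.
  have hS : in_cone (k0 + j * nb) l.
    by rewrite /in_cone mulnDr addnA dvdn_add // mulnA dvdn_mull.
  by rewrite -hC // van // hkl orbT.
have := hP ((k%:R - k0%:R) / nb%:R); rewrite P0 horner0 mulr0 addr0.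
by rewrite divfK // addrC subrK.
Qed.

End PolynomialFunctions.

(** * The ring of invariants *)

Definition mk (p q : nat) : 'X_{1..2} := [multinom [tuple p; q]].

Lemma mk0 p q : mk p q ord0 = p. Proof. by rewrite multinomE. Qed.
Lemma mk1 p q : mk p q ord_max = q. Proof. by rewrite multinomE. Qed.

Lemma mnm2P (m m' : 'X_{1..2}) :
  m ord0 = m' ord0 -> m ord_max = m' ord_max -> m = m'.
Proof.
move=> e0 e1; apply/mnmP => -[[|[|//]] h].
  by rewrite (_ : Ordinal h = ord0) //; apply: val_inj.
by rewrite (_ : Ordinal h = ord_max) //; apply: val_inj.
Qed.

Lemma mkE (m : 'X_{1..2}) : m = mk (m ord0) (m ord_max).
Proof. by apply: mnm2P; rewrite ?mk0 ?mk1. Qed.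

Lemma mkD p q s t : (mk p q + mk s t)%MM = mk (p + s) (q + t).
Proof. by apply: mnm2P; rewrite mnmDE ?mk0 ?mk1. Qed.

Lemma mk00 : mk 0 0 = 0%MM.
Proof. by apply: mnm2P; rewrite mnm0E ?mk0 ?mk1. Qed.

Lemma eq_mk p q s t : (mk p q == mk s t) = (p == s) && (q == t).
Proof.
apply/eqP/andP => [e|[/eqP-> /eqP->//]].
by rewrite -(mk0 p q) -(mk1 p q) e mk0 mk1.
Qed.

Lemma mdeg_mk p q : mdeg (mk p q) = (p + q)%N.
Proof.
by rewrite mdegE big_ord_recl big_ord1 mk0; congr (_ + _)%N.
Qed.

Section LRMorphism.
Variables (K : fieldType) (A B : comAlgType K).

Lemma lrmorphism_of (f : A -> B) : linear f -> f 1 = 1 ->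
  {morph f : x y / x * y} -> {g : {lrmorphism A -> B} | g =1 f}.
Proof.
move=> lf f1 fM.
pose L := GRing.isLinear.Build K A B *:%R f lf.
pose M := GRing.isMonoidMorphism.Build A B f (conj f1 fM).
pose g : {lrmorphism A -> B} := HB.pack f L M.
by exists g.
Qed.

End LRMorphism.

(** * Differential operators on a commutative ring *)

Section DifferentialOperators.
Variable C : comNzRingType.
Implicit Types (P : C -> C).

(* Grothendieck differential operators of order < d. *)
Fixpoint diffop (d : nat) P : Prop :=
  if d is d'.+1 then forall f, diffop d' (fun g => P (f * g) - f * P g)
  else forall g, P g = 0.

Lemma diffop_ext d P Q : P =1 Q -> diffop d P -> diffop d Q.
Proof.
elim: d P Q => [|d IH] P Q e /= h; first by move=> g; rewrite -e.
by move=> f; apply: IH (h f) => g; rewrite !e.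
Qed.

Lemma diffopD d P Q : diffop d P -> diffop d Q -> diffop d (fun g => P g + Q g).
Proof.
elim: d P Q => [|d IH] P Q /= hP hQ; first by move=> g; rewrite hP hQ addr0.
move=> f; apply: diffop_ext (IH _ _ (hP f) (hQ f)) => g /=.
by rewrite mulrDr opprD addrACA.
Qed.

Lemma diffopM d h P : diffop d P -> diffop d (fun g => h * P g).
Proof.
elim: d P => [|d IH] P /= hP; first by move=> g; rewrite hP mulr0.
move=> f; apply: diffop_ext (IH _ (hP f)) => g /=.
by rewrite mulrBr (mulrCA h f).
Qed.

Lemma diffop_id : diffop 1 id.
Proof. by move=> f g /=; rewrite subrr. Qed.

(** By induction from [[D P, f] = D [P, f] + D(f) P]. *)
Lemma diffop_derivation d P (D : {additive C -> C}) :
    (forall f g, D (f * g) = D f * g + f * D g) ->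
  diffop d P -> diffop d.+1 (fun g => D (P g)).
Proof.
move=> DM; elim: d P => [|d IH] P hP f.
  by move=> g /=; rewrite !hP raddf0 mulr0 subr0.
rewrite -/(diffop d.+1 _).
apply: (@diffop_ext d.+1 (fun g => D (P (f * g) - f * P g) + D f * P g)).
  by move=> g; rewrite raddfB DM opprD addrA addrAC subrK.
by apply: diffopD; [apply: IH; apply: hP | apply: diffopM].
Qed.

End DifferentialOperators.

Lemma diffop_mderivm (R : comNzRingType) p q :
  diffop (p + q).+1 (mderivm (mk p q) : {mpoly R[2]} -> {mpoly R[2]}).
Proof.
have mkS0 m n : mk m.+1 n = (mk m n + U_(ord0))%MM.
  by apply: mnm2P; rewrite mnmDE mnm1E !(mk0, mk1) ?addn1 ?addn0.
have mkS1 m n : mk m n.+1 = (mk m n + U_(ord_max))%MM.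
  by apply: mnm2P; rewrite mnmDE mnm1E !(mk0, mk1) ?addn1 ?addn0.
elim: p => [|p IH].
  elim: q => [|q IH].
    by apply: diffop_ext (@diffop_id _) => f; rewrite mk00 mderivm0m.
  rewrite addnS; apply: diffop_ext (diffop_derivation (D := mderiv ord_max) _ IH).
    by move=> f /=; rewrite mkS1 mderivmDm mderivmU1m.
  exact: mderivM.
rewrite addSn; apply: diffop_ext (diffop_derivation (D := mderiv ord0) _ IH).
  by move=> f /=; rewrite mkS0 mderivmDm mderivmU1m.
exact: mderivM.
Qed.

Lemma horner_monomial (C : comNzRingType) (P Q : {poly C}) p q c F G :
  P.[c] = F -> Q.[c] = G -> (P ^+ p * Q ^+ q).[c] = F ^+ p * G ^+ q.
Proof. by move=> <- <-; rewrite hornerM !horner_exp. Qed.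

Section InvariantRing.
Variables (K : closedFieldType) (na nb : nat).
Hypothesis char0 : forall n, n.+1%:R != 0 :> K.
Hypothesis nb_gt0 : (0 < nb)%N.
Hypothesis na_le : (na <= nb)%N.
Hypothesis cop : coprime na nb.

Local Notation B := {mpoly K[2]}.
Local Notation S := (in_cone na nb).

(* A is the ring of invariants and rho its Reynolds operator. *)
Variables (A : comAlgType K) (iota : {lrmorphism A -> B}).
Variable rho : {linear B -> A}.
Hypothesis iotaK : cancel iota rho.
Hypothesis iota_rhoX : forall p q,
  iota (rho 'X_[mk p q]) = if S p q then 'X_[mk p q] else 0.

(** The monomial [x^p y^q] inside [A]; it is zero when [S p q] fails. *)
Definition chi p q : A := rho 'X_[mk p q].
Definition cf (f : A) p q : K := (iota f)@_(mk p q).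

Lemma iota_inj : injective iota. Proof. exact: can_inj iotaK. Qed.

Lemma iota_chi p q : S p q -> iota (chi p q) = 'X_[mk p q].
Proof. by move=> h; rewrite /chi iota_rhoX h. Qed.

Lemma cf_chi p q s t : S p q -> cf (chi p q) s t = ((p == s) && (q == t))%:R.
Proof. by move=> h; rewrite /cf iota_chi // mcoeffX eq_mk. Qed.

Lemma chiM p q s t : S p q -> S s t -> chi p q * chi s t = chi (p + s) (q + t).
Proof.
move=> h h'; apply: iota_inj; rewrite rmorphM /= !iota_chi ?in_coneD //.
by rewrite -mpolyXD mkD.
Qed.

Lemma chi00 : chi 0 0 = 1.
Proof. by apply: iota_inj; rewrite iota_chi ?in_cone_00 // rmorph1 mk00 mpolyX0. Qed.

Lemma chiX p q k : S p q -> chi p q ^+ k = chi (k * p) (k * q) /\ S (k * p) (k * q).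
Proof.
move=> h; elim: k => [|k [e h']]; first by rewrite expr0 chi00 !mul0n in_cone_00.
by rewrite exprS e !mulSn chiM // in_coneD.
Qed.

Lemma expand f : f = \sum_(m <- msupp (iota f)) (iota f)@_m *: rho 'X_[m].
Proof.
rewrite -{1}(iotaK f) {1}[iota f]mpolyE linear_sum.
by apply: eq_bigr => m _; rewrite linearZ_LR.
Qed.

Lemma cf_out f p q : ~~ S p q -> cf f p q = 0.
Proof.
move=> h; rewrite /cf {1}(expand f) !raddf_sum /= big1 // => m _.
rewrite linearZ /= mcoeffZ (mkE m) iota_rhoX; case: ifP => h'.
  rewrite mcoeffX eq_mk; have [e|_] := eqVneq (m ord0) p; last by rewrite mulr0.
  have [e'|_] := eqVneq (m ord_max) q; last by rewrite mulr0.
  by rewrite e e' (negbTE h) in h'.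
by rewrite mcoeff0 mulr0.
Qed.

Lemma rho_out p q : ~~ S p q -> rho 'X_[mk p q] = 0.
Proof. by move=> h; apply: iota_inj; rewrite iota_rhoX (negbTE h) rmorph0. Qed.

Lemma cf_ext f g : (forall p q, S p q -> cf f p q = cf g p q) -> f = g.
Proof.
move=> h; apply: iota_inj; apply/mpolyP => m; rewrite (mkE m).
case: (boolP (S (m ord0) (m ord_max))) => [/h//|h'].
by have := cf_out f h'; have := cf_out g h'; rewrite /cf => -> ->.
Qed.

Lemma lin_ext (V : lmodType K) (f g : {linear A -> V}) :
  (forall p q, S p q -> f (chi p q) = g (chi p q)) -> f =1 g.
Proof.
move=> h x; rewrite (expand x) !linear_sum; apply: eq_bigr => m _.
rewrite !linearZ (mkE m); congr (_ *: _).
case: (boolP (S (m ord0) (m ord_max))) => [/h//|h'].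
by rewrite rho_out // !linear0.
Qed.

Lemma span_ind (P : A -> Prop) :
  P 0 -> (forall c f g, P f -> P g -> P (c *: f + g)) ->
  (forall p q, S p q -> P (chi p q)) -> forall f, P f.
Proof.
move=> P0 PD PX f; rewrite (expand f).
elim/big_rec: _ => // m g _ Pg; apply: PD => //; rewrite (mkE m).
case: (boolP (S (m ord0) (m ord_max))) => [/PX//|h'].
by rewrite rho_out.
Qed.

Lemma lin_extB (V : lmodType K) (f g : {linear B -> V}) :
  (forall p q, f 'X_[mk p q] = g 'X_[mk p q]) -> f =1 g.
Proof.
move=> h x; rewrite [x]mpolyE !linear_sum; apply: eq_bigr => m _.
by rewrite !linearZ (mkE m) h.
Qed.

Lemma cf0 p q : cf 0 p q = 0.
Proof. by rewrite /cf rmorph0 mcoeff0. Qed.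
Lemma cfD f g p q : cf (f + g) p q = cf f p q + cf g p q.
Proof. by rewrite /cf rmorphD mcoeffD. Qed.
Lemma cfB f g p q : cf (f - g) p q = cf f p q - cf g p q.
Proof. by rewrite /cf rmorphB mcoeffB. Qed.
Lemma cfZ k f p q : cf (k *: f) p q = k * cf f p q.
Proof. by rewrite /cf linearZ mcoeffZ. Qed.
Lemma mcoeff_mulX (g : B) s t p q : ('X_[mk s t] * g)@_(mk p q) =
  if (s <= p)%N && (t <= q)%N then g@_(mk (p - s) (q - t)) else 0.
Proof.
rewrite mulrC; case: ifP => [/andP[h h']|h].
  by rewrite -{1}(subnKC h) -{1}(subnKC h') -mkD mcoeffMX.
apply: memN_msupp_eq0; rewrite (perm_mem (msuppMX g (mk s t))).
apply/mapP => -[m _ e]; move: h.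
have := congr1 (fun u : 'X_{1..2} => u ord0) e.
have := congr1 (fun u : 'X_{1..2} => u ord_max) e.
by rewrite !mnmDE !mk0 !mk1 => -> ->; rewrite !leq_addr.
Qed.

Lemma cf_mulchi f s t p q : S s t -> cf (chi s t * f) p q =
  if (s <= p)%N && (t <= q)%N then cf f (p - s) (q - t) else 0.
Proof. by move=> h; rewrite /cf rmorphM /= iota_chi // mcoeff_mulX. Qed.

Lemma in_coneDl p q s t : S s t -> S (s + p) (t + q) = S p q.
Proof.
rewrite /in_cone => h; rewrite mulnDr addnACA dvdn_addr //.
Qed.

(** The Reynolds operator is [A]-linear: multiplying a monomial by an invariant one does not change
    whether it is invariant. *)
Lemma rho_iotaM f g : rho (iota f * g) = f * rho g.
Proof.
move: g; suff H : forall h, rho (iota f * h) = f * rho h by exact: H.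
move=> h; rewrite [h]mpolyE mulr_sumr !linear_sum mulr_sumr.
apply: eq_bigr => m _; rewrite -scalerAr !linearZ /= -scalerAr; congr (_ *: _).
rewrite (expand f) !linear_sum /= mulr_suml !linear_sum mulr_suml.
apply: eq_bigr => m' _; rewrite !linearZ /= -!scalerAl linearZ; congr (_ *: _).
rewrite (mkE m) (mkE m') iota_rhoX; case: ifP => h'; last first.
  by rewrite mul0r linear0 rho_out ?h' // mul0r.
rewrite -mpolyXD mkD; case: (boolP (S (m ord0) (m ord_max))) => h''.
  by rewrite -[RHS]/(chi _ _ * chi _ _) chiM.
by rewrite (rho_out h'') mulr0 rho_out // in_coneDl.
Qed.

(** * Differential operators and the degree filtration *)

(* The value of f at the vertex. *)
Definition eps (f : A) : K := cf f 0 0.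

Lemma epsM f g : eps (f * g) = eps f * eps g.
Proof. by rewrite /eps /cf mk00 !rmorphM. Qed.

(* The coefficient of P (chi p q) at (p, q) + (s, t) - (p0, q0): for a fixed
   shift, these are the entries of one homogeneous component of P. *)
Definition shiftcf (s t p0 q0 : nat) (P : A -> A) p q : K :=
  if (p0 <= p + s)%N && (q0 <= q + t)%N
  then cf (P (chi p q)) (p + s - p0) (q + t - q0) else 0.

(** The entries of the commutator of [P] with [chi s' t'], for the shift increased by [(s', t')],
    are the differences of the entries of [P] along [(s', t')]. The shift [(s, t)] is therefore
    general in the induction. *)
Lemma diffop_pol_on d P s t p0 q0 : diffop d P ->
  pol_on na nb d (shiftcf s t p0 q0 P).
Proof.
elim: d P s t => [|d IH] P s t /=.
  by move=> h p q _; rewrite /shiftcf h cf0 if_same.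
move=> h s' t' S'.
have := IH _ (s + s')%N (t + t')%N (h (chi s' t')).
set c1 := shiftcf _ _ _ _ _; set c2 := fdiff _ _ _.
apply: pol_on_ext => p q Sp.
rewrite /c1 /c2 /fdiff /shiftcf cfB chiM // cf_mulchi //.
have -> : (s' + p + s = p + (s + s'))%N by lia.
have -> : (t' + q + t = q + (t + t'))%N by lia.
case: (boolP ((p0 <= p + (s + s')) && (q0 <= q + (t + t')))%N) => h1; last first.
  rewrite ifF ?subr0 //; apply/negbTE; apply: contra h1 => /andP[h1 h2].
  by apply/andP; lia.
congr (_ - _).
have -> : ((s' <= p + (s + s') - p0) = (p0 <= p + s))%N by lia.
have -> : ((t' <= q + (t + t') - q0) = (q0 <= q + t))%N by lia.
by case: ifP => // /andP[h2 h3]; congr (cf _ _ _); lia.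
Qed.

(** The component of [P] that shifts exponents by [(-p, -q)] has zero entries at all [(p', q')] with
    [p' < p] or [q' < q], where the target exponent would be negative. Its entries have degree
    [< d], so [pol_on_vanish] kills the one at [(p, q)], which is the value at the vertex. *)
Lemma diffop_eps d P p q : diffop d P -> (d <= p + q)%N -> S p q ->
  eps (P (chi p q)) = 0.
Proof.
move=> hP le_d Sp.
have : shiftcf 0 0 p q P p q = 0.
  apply: (pol_on_vanish char0 nb_gt0 na_le cop (diffop_pol_on 0 0 p q hP)) => //.
  by move=> p' q' _ h; rewrite /shiftcf !addn0 ifF //; lia.
by rewrite /shiftcf !addn0 !leqnn !subnn.
Qed.

Lemma diffop_conj d P (phi psi : {lrmorphism A -> A}) :
  cancel phi psi -> diffop d P -> diffop d (fun g => psi (P (phi g))).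
Proof.
move=> phiK; elim: d P => [|d IH] P /= h; first by move=> g; rewrite h rmorph0.
move=> f; apply: diffop_ext (IH _ (h (phi f))) => g /=.
by rewrite rmorphB /= [phi (f * g)]rmorphM /= rmorphM /= phiK.
Qed.

(** By [A]-linearity of [rho], commutators with elements of [A] pass through it; this makes the
    partial derivatives of [B] available on [A]. *)
Lemma diffop_rho d (P : B -> B) :
  diffop d P -> diffop d (fun g => rho (P (iota g))).
Proof.
elim: d P => [|d IH] P /= h; first by move=> g; rewrite h linear0.
move=> f; apply: diffop_ext (IH _ (h (iota f))) => g /=.
by rewrite linearB rho_iotaM rmorphM.
Qed.

Lemma eps_rho g : eps (rho g) = g@_0.
Proof.
rewrite [g in RHS]mpolyE {1}[g]mpolyE /eps /cf !raddf_sum /=.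
apply: eq_bigr => m _; rewrite !linearZ /= (mkE m) iota_rhoX.
case: ifP => h; first by rewrite mk00.
rewrite mcoeff0 mulr0 mcoeffX -mk00 eq_mk.
have [e|_] := eqVneq (m ord0) 0%N; last by rewrite mulr0.
have [e'|_] := eqVneq (m ord_max) 0%N; last by rewrite mulr0.
by rewrite e e' in_cone_00 in h.
Qed.

Lemma in_cone_small p q : (1 < nb)%N -> S p q -> (p + q < 2)%N -> p = 0%N /\ q = 0%N.
Proof.
move=> nb1; case: p q => [|[|p]] [|[|q]] //=; rewrite /in_cone ?muln0 ?muln1 ?add0n ?addn0.
- by rewrite dvdn1 => /eqP e; rewrite e in nb1.
- by move=> h; move: cop; rewrite /coprime (gcdn_idPr h) => /eqP e; rewrite e in nb1.
Qed.

(* The vertex is the only point preserved by all derivations of A, as no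
   derivation of degree -1 exists, whereas the Euler derivation moves any
   other point. *)
Lemma aut_eps (phi psi : {lrmorphism A -> A}) : (1 < nb)%N ->
  cancel phi psi -> cancel psi phi -> forall f, eps (phi f) = eps f.
Proof.
move=> nb1 phiK psiK.
(* The Euler derivation, which multiplies a monomial by its degree. *)
pose E (g : B) : B := 'X_ord0 * g^`M(ord0) + 'X_ord_max * g^`M(ord_max).
have EX p q : E 'X_[mk p q] = (p + q)%:R *: 'X_[mk p q].
  have Xd i : 'X_i * ('X_[mk p q])^`M(i) = (mk p q i)%:R *: 'X_[mk p q] :> B.
    rewrite mderivX -scalerAr -mpolyXD.
    case: (posnP (mk p q i)) => [->|h]; first by rewrite !scale0r.
    by rewrite addmC submK // lep1mP -lt0n.
  by rewrite /E !Xd mk0 mk1 natrD scalerDl.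
have dE : diffop 2 E.
  apply: diffopD; apply: diffopM.
    by apply: (diffop_derivation (D := mderiv ord0) (mderivM _) (@diffop_id _)).
  by apply: (diffop_derivation (D := mderiv ord_max) (mderivM _) (@diffop_id _)).
have dQ := diffop_conj psiK (diffop_rho dE).
have EL : linear E.
  move=> a f g; rewrite /E !mderivD !mderivZ !mulrDr -!scalerAr scalerDr.
  by rewrite addrACA.
have epsP c f g : eps (c *: f + g) = c * eps f + eps g by rewrite /eps cfD cfZ.
have Q0 f : eps (phi (rho (E (iota (psi f))))) = 0.
  elim/span_ind: f => [|c f g Pf Pg|p q Sp].
  - by rewrite !rmorph0 /E !mderiv0 !mulr0 addr0 linear0 rmorph0 /eps cf0.
  - by rewrite !linearP EL !linearP epsP Pf Pg mulr0 addr0.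
  (* The conjugated operator has order [< 2], which settles degrees at least 2; in lower degrees the
     cone contains only the constants, and [E] kills them. *)
  case: (ltnP (p + q) 2) => [/(in_cone_small nb1 Sp)[-> ->]|h].
    rewrite chi00 !rmorph1 /E -mpolyC1 !mderivC !mulr0 addr0 linear0.
    by rewrite rmorph0 /eps cf0.
  exact: (diffop_eps dQ).
elim/span_ind => [|c f g Pf Pg|p q Sp]; first by rewrite rmorph0.
  by rewrite linearP !epsP Pf Pg.
case: (posnP (p + q)) => [/eqP|h].
  by rewrite addn_eq0 => /andP[/eqP-> /eqP->]; rewrite chi00 rmorph1.
(* Here [Q0] reads [(p + q) * eps (phi (chi p q)) = 0]. *)
have := Q0 (phi (chi p q)); rewrite phiK iota_chi //= EX !linearZ /=.
rewrite /eps cfZ => /eqP; rewrite mulf_eq0 -{1}(prednK h).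
rewrite (negbTE (char0 _)) /= => /eqP ->; rewrite cf_chi //.
have [e|//] := eqVneq p 0%N.
by have [e'|//] := eqVneq q 0%N; rewrite e e' in h.
Qed.

(** Up to the nonzero factor [p'! q'!], the coefficient at [(p', q')] is the value at the vertex of
    the partial derivative of that multi-index. Its conjugate by [phi] again has order at most
    [p' + q' < p + q], and [diffop_eps] applies to it. *)
Lemma aut_filtered (phi psi : {lrmorphism A -> A}) p q p' q' :
    cancel phi psi -> cancel psi phi -> (forall f, eps (phi f) = eps f) ->
  S p q -> (p' + q' < p + q)%N -> cf (phi (chi p q)) p' q' = 0.
Proof.
move=> phiK psiK ephi Sp lt.
case: (boolP (S p' q')) => [Sp'|/cf_out//].
have dQ := diffop_conj phiK (diffop_rho (@diffop_mderivm K p' q')).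
have := diffop_eps dQ lt Sp.
rewrite -ephi psiK eps_rho mcoeff_mderivm addm0 -mulr_natr => /eqP.
rewrite mulf_eq0 => /orP[/eqP//|].
rewrite natr_prod prodf_seq_eq0 => /hasP[i _] /=; rewrite ffactnn.
by rewrite -(prednK (fact_gt0 _)) (negbTE (char0 _)).
Qed.

(** * Families of automorphisms and degeneration *)

(** The linear map on [B] with prescribed values [h p q] on the monomials. *)
Definition lin_extend (V : lmodType K) (h : nat -> nat -> V) (g : B) : V :=
  \sum_(m <- msupp g) g@_m *: h (m ord0) (m ord_max).

Lemma lin_extendwE (V : lmodType K) (h : nat -> nat -> V) (g : B) k : (msize g <= k)%N ->
  lin_extend h g = \sum_(m : 'X_{1..2 < k}) g@_m *: h (m ord0) (m ord_max).
Proof.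
move=> le_k; pose I : subFinType _ := 'X_{1..2 < k}.
rewrite /lin_extend (big_mksub I) //=; first last.
  by move=> m /msize_mdeg_lt /leq_trans; apply.
  by rewrite msupp_uniq.
rewrite big_rmcond //= => i; move/memN_msupp_eq0 ->.
by rewrite scale0r.
Qed.

Lemma lin_extend_linear (V : lmodType K) (h : nat -> nat -> V) : linear (lin_extend h).
Proof.
move=> c f g; pose k := maxn (msize (c *: f + g)) (maxn (msize f) (msize g)).
rewrite !(@lin_extendwE V h _ k) ?leq_max ?leqnn ?orbT // scaler_sumr -big_split.
by apply: eq_bigr => m _ /=; rewrite mcoeffD mcoeffZ scalerDl scalerA.
Qed.

Lemma lin_extendX (V : lmodType K) (h : nat -> nat -> V) p q :
  lin_extend h 'X_[mk p q] = h p q.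
Proof. by rewrite /lin_extend msuppX big_seq1 mcoeffX eqxx scale1r mk0 mk1. Qed.

Lemma inverse_lrmorphism (f : {lrmorphism A -> A}) : bijective f ->
  exists g : {lrmorphism A -> A}, cancel f g /\ cancel g f.
Proof.
case=> g fK gK.
have lg : linear g by move=> c x y; apply: (can_inj fK); rewrite linearP /= !gK.
have g1 : g 1 = 1 by rewrite -{1}(rmorph1 f) fK.
have gM : {morph g : x y / x * y}.
  by move=> x y; apply: (can_inj fK); rewrite rmorphM /= !gK.
have [g' eg'] := lrmorphism_of lg g1 gM.
by exists g'; split=> x; rewrite eg' ?fK ?gK.
Qed.

Definition polyfam (Phi : K -> {lrmorphism A -> A}) : Prop :=
  forall f, exists G : {poly A}, forall t, Phi t f = G.[t%:A].

(* Families over open subsets of the affine line are enough: two of them can be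
   composed over the intersection of their bases, without products of varieties.
   Phi t is allowed to be degenerate where h vanishes. *)
Definition conn (f0 f1 : {lrmorphism A -> A}) : Prop :=
  exists (h : {poly K}) (Phi : K -> {lrmorphism A -> A}),
    [/\ h.[0] != 0 /\ h.[1] != 0, forall t, h.[t] != 0 -> bijective (Phi t),
        Phi 0 =1 f0, Phi 1 =1 f1 & polyfam Phi].

Lemma polyfam_chi (Phi : K -> {lrmorphism A -> A}) :
  (forall p q, S p q ->
    exists G : {poly A}, forall t, Phi t (chi p q) = G.[t%:A]) ->
  polyfam Phi.
Proof.
move=> h; apply: span_ind => //.
  by exists 0 => t; rewrite rmorph0 horner0.
move=> c f g [F hF] [G hG]; exists (c%:A *: F + G) => t.
by rewrite linearP /= hF hG !hornerE mulr_algl.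
Qed.

Lemma polyfam_comp Phi Psi (theta : {lrmorphism A -> A}) :
  polyfam Phi -> polyfam Psi ->
  polyfam (fun t => Phi t \o theta \o Psi t : {lrmorphism A -> A}).
Proof.
move=> hP hQ f; have [G hG] := hQ f.
have /fin_all_exists[H hH] : forall i : 'I_(size G), exists H : {poly A},
  forall t, Phi t (theta G`_i) = H.[t%:A] by move=> i; apply: hP.
exists (\sum_i H i * 'X^i) => t /=.
rewrite hG horner_coef !rmorph_sum horner_sum; apply: eq_bigr => i _ /=.
rewrite !rmorphM /= hH !hornerE; congr (_ * _).
by rewrite !rmorphXn /= !rmorph_alg.
Qed.

Definition filtered (phi : A -> A) : Prop :=
  forall p q p' q', S p q -> (p' + q' < p + q)%N -> cf (phi (chi p q)) p' q' = 0.

Section Degeneration.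
Variable t : K.

(* t^-d f(t x, t y), also at t = 0: the subtraction only truncates on monomials
   of degree < d, which vanish_below excludes. *)
Definition rescale (d : nat) (f : A) : A :=
  lin_extend (fun p q => t ^+ (p + q - d) *: chi p q) (iota f).

Lemma rescale_linear d : linear (rescale d).
Proof. by move=> c f g; rewrite /rescale linearP lin_extend_linear. Qed.
HB.instance Definition _ d :=
  GRing.isLinear.Build K A A *:%R (rescale d) (rescale_linear d).

Lemma rescale_chi d p q : S p q -> rescale d (chi p q) = t ^+ (p + q - d) *: chi p q.
Proof. by move=> h; rewrite /rescale iota_chi // lin_extendX. Qed.

Lemma cf_rescale d f p q : cf (rescale d f) p q = t ^+ (p + q - d) * cf f p q.
Proof.
elim/span_ind: f => [|c f g hf hg|p' q' h].
- by rewrite linear0 !cf0 mulr0.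
- by rewrite linearP !(cfD, cfZ) hf hg; ring.
rewrite rescale_chi // cfZ cf_chi //.
by do 2![case: eqVneq => [->|]; rewrite ?mulr0 //].
Qed.

Definition vanish_below (d : nat) (f : A) : Prop :=
  forall p q, (p + q < d)%N -> cf f p q = 0.

Lemma vanish_below_ind d (P : A -> Prop) :
  P 0 -> (forall c f g, P f -> P g -> P (c *: f + g)) ->
  (forall p q, S p q -> (d <= p + q)%N -> P (chi p q)) ->
  forall f, vanish_below d f -> P f.
Proof.
move=> P0 PD PX f hf; rewrite (expand f) big_seq.
elim/big_rec: _ => // m g hm Pg; apply: PD => //; rewrite (mkE m).
move: hm; rewrite mcoeff_msupp => hm; rewrite (mkE m) in hm.
apply: PX; first by apply: contraT => /cf_out h; rewrite -/(cf f _ _) h eqxx in hm.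
rewrite leqNgt; apply/negP => /hf h.
by rewrite -/(cf f _ _) h eqxx in hm.
Qed.

Lemma rescaleM d e f g : vanish_below d f -> vanish_below e g ->
  rescale (d + e) (f * g) = rescale d f * rescale e g.
Proof.
move=> hf hg; move: f hf; apply: vanish_below_ind => [|c f f' h h'|p q Sp dp].
- by rewrite mul0r !linear0 mul0r.
- by rewrite mulrDl -scalerAl !linearP /= h h' mulrDl -scalerAl.
move: g hg; apply: vanish_below_ind => [|c f f' h h'|s u Su es].
- by rewrite mulr0 !linear0 mulr0.
- by rewrite mulrDr -scalerAr !linearP /= h h' mulrDr -scalerAr.
rewrite chiM // !rescale_chi ?in_coneD // -scalerAl -scalerAr chiM // scalerA -exprD.
by congr (_ ^+ _ *: _); lia.
Qed.

Variable phi : {lrmorphism A -> A}.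
Hypothesis phi_filtered : filtered phi.

(** For [t != 0] this is the conjugate of [phi] by the scaling [(x, y) |-> (t x, t y)]; for [t = 0]
    it is the graded map associated with [phi]. *)
Definition degenerate (f : A) : A :=
  lin_extend (fun p q => rescale (p + q) (phi (chi p q))) (iota f).

Lemma degenerate_linear : linear degenerate.
Proof. by move=> c f g; rewrite /degenerate linearP lin_extend_linear. Qed.
HB.instance Definition _ :=
  GRing.isLinear.Build K A A *:%R degenerate degenerate_linear.

Lemma degenerate_chi p q : S p q ->
  degenerate (chi p q) = rescale (p + q) (phi (chi p q)).
Proof. by move=> h; rewrite /degenerate iota_chi // lin_extendX. Qed.

Lemma degenerate1 : degenerate 1 = 1.
Proof.
rewrite -chi00 degenerate_chi ?in_cone_00 // chi00 rmorph1 -chi00 rescale_chi ?in_cone_00 //.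
by rewrite expr0 scale1r.
Qed.

Lemma degenerateM : {morph degenerate : f g / f * g}.
Proof.
move=> f g; elim/span_ind: f => [|c f f' h h'|p q Sp].
- by rewrite mul0r !linear0 mul0r.
- by rewrite mulrDl -scalerAl !linearP /= h h' mulrDl -scalerAl.
elim/span_ind: g => [|c f f' h h'|s u Su].
- by rewrite mulr0 !linear0 mulr0.
- by rewrite mulrDr -scalerAr !linearP /= h h' mulrDr -scalerAr.
rewrite chiM // !degenerate_chi ?in_coneD // -chiM // rmorphM.
rewrite -rescaleM; first by congr (rescale _ _); lia.
  by move=> p' q'; apply: phi_filtered.
by move=> p' q'; apply: phi_filtered.
Qed.

(** The conjugation relation written without inverting [t]. It makes the degenerations of inverse
    maps inverse to each other even at [t = 0]. *)
Lemma degenerate_rescale d f : vanish_below d f ->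
  degenerate (rescale d f) = rescale d (phi f).
Proof.
move: f; apply: vanish_below_ind => [|c f f' h h'|p q Sp dp].
- by rewrite !linear0.
- by rewrite !linearP /= h h'.
rewrite rescale_chi // linearZ /= degenerate_chi //; apply: cf_ext => s u _.
rewrite cfZ !cf_rescale; case: (ltnP (s + u) (p + q)) => h.
  by rewrite phi_filtered // !mulr0.
by rewrite mulrA -exprD; congr (_ ^+ _ * _); lia.
Qed.

End Degeneration.

Lemma degenerateK t (phi psi : {lrmorphism A -> A}) :
  filtered phi -> filtered psi -> cancel phi psi ->
  cancel (degenerate t phi) (degenerate t psi).
Proof.
move=> fphi fpsi phiK; elim/span_ind => [|c f f' h h'|p q Sp].
- by rewrite !linear0.
- by rewrite !linearP /= h h'.
rewrite degenerate_chi // degenerate_rescale //; last by move=> ? ?; apply: fphi.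
by rewrite phiK rescale_chi // subnn expr0 scale1r.
Qed.

Lemma degeneration (phi psi : {lrmorphism A -> A}) :
    filtered phi -> filtered psi -> cancel phi psi -> cancel psi phi ->
  exists gphi gpsi : {lrmorphism A -> A},
    [/\ cancel gphi gpsi, cancel gpsi gphi, conn gphi phi,
    forall p q p' q', S p q -> cf (gphi (chi p q)) p' q' =
      if (p' + q' == p + q)%N then cf (phi (chi p q)) p' q' else 0 &
    forall p q p' q', S p q -> cf (gpsi (chi p q)) p' q' =
      if (p' + q' == p + q)%N then cf (psi (chi p q)) p' q' else 0].
Proof.
move=> fphi fpsi phiK psiK.
pose Phi t := sval (lrmorphism_of (degenerate_linear t phi)
  (degenerate1 t phi) (degenerateM t fphi)).
pose Psi t := sval (lrmorphism_of (degenerate_linear t psi)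
  (degenerate1 t psi) (degenerateM t fpsi)).
have PhiE t : Phi t =1 degenerate t phi by rewrite /Phi; case: lrmorphism_of.
have PsiE t : Psi t =1 degenerate t psi by rewrite /Psi; case: lrmorphism_of.
have PhiK t : cancel (Phi t) (Psi t).
  by move=> f; rewrite PhiE PsiE degenerateK.
have PsiK t : cancel (Psi t) (Phi t).
  by move=> f; rewrite PhiE PsiE degenerateK.
have at0 (theta : {lrmorphism A -> A}) p q p' q' : filtered theta -> S p q ->
    cf (degenerate 0 theta (chi p q)) p' q' =
      if (p' + q' == p + q)%N then cf (theta (chi p q)) p' q' else 0.
  move=> ft Sp; rewrite degenerate_chi // cf_rescale expr0n.
  case: (ltngtP (p' + q') (p + q)) => h; first by rewrite ft // mulr0.
    by rewrite -(subnSK h) mul0r.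
  by rewrite h subnn mul1r.
exists (Phi 0), (Psi 0); split=> //; last 2 first.
- by move=> *; rewrite PhiE at0.
- by move=> *; rewrite PsiE at0.
(* The degenerations are bijective for every [t], so the base is the whole line and [h = 1]. *)
exists 1, Phi; split=> //; first by rewrite !hornerE oner_neq0.
- by move=> t _; exists (Psi t).
- move=> f; rewrite PhiE; elim/span_ind: f => [|c f f' h h'|p q Sp].
  + by rewrite !linear0.
  + by rewrite !linearP /= h h'.
  rewrite degenerate_chi //; apply: cf_ext => s u _.
  by rewrite cf_rescale expr1n mul1r.
apply: polyfam_chi => p q Sp.
exists (\sum_(m <- msupp (iota (phi (chi p q))))
   ((iota (phi (chi p q)))@_m *: chi (m ord0) (m ord_max)) *:
     'X^(m ord0 + m ord_max - (p + q))) => t.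
rewrite PhiE degenerate_chi // /rescale /lin_extend horner_sum.
apply: eq_bigr => m _; rewrite !hornerE -scalerAl; congr (_ *: _).
have -> : t%:A ^+ (m ord0 + m ord_max - (p + q)) =
   (t ^+ (m ord0 + m ord_max - (p + q)))%:A :> A.
  by rewrite -!in_algE rmorphXn.
by rewrite -scalerAr mulr1.
Qed.

(** With [g] the inverse of the common endpoint [f1], the family [Phi t \o g \o Psi t] runs from
    [f0] to [f2]. It is invertible wherever both given families are, that is, where [h * h'] does
    not vanish. *)
Lemma conn_trans f0 f1 f2 : conn f0 f1 -> conn f1 f2 -> conn f0 f2.
Proof.
case=> h [Phi [[h0 h1] hb P0 P1 pP]] [h' [Psi [[h0' h1'] hb' P0' P1' pP']]].
have [g [fg gf]] := inverse_lrmorphism (hb 1 h1).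
have gb : bijective g by exists (Phi 1).
exists (h * h'), (fun t => Phi t \o g \o Psi t : {lrmorphism A -> A}); split.
- by rewrite !hornerM !mulf_neq0.
- move=> t; rewrite hornerM mulf_eq0 => /norP[/hb b1 /hb' b2].
  by apply: bij_comp b2; apply: bij_comp gb.
- by move=> f /=; rewrite P0' -P1 fg P0.
- by move=> f /=; rewrite gf P1'.
exact: polyfam_comp.
Qed.

Lemma conn_compr f0 f1 (theta : {lrmorphism A -> A}) : bijective theta ->
  conn f0 f1 -> conn (f0 \o theta) (f1 \o theta).
Proof.
move=> tb [h [Phi [[h0 h1] hb P0 P1 pP]]].
exists h, (fun t => Phi t \o theta : {lrmorphism A -> A}); split=> //.
- by move=> t /hb b; apply: bij_comp.
- by move=> f /=.
- by move=> f /=.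
by move=> f; apply: pP.
Qed.

Lemma conn_eq (f0 f1 g0 g1 : {lrmorphism A -> A}) :
  f0 =1 g0 -> f1 =1 g1 -> conn f0 f1 -> conn g0 g1.
Proof.
move=> e0 e1 [h [Phi [hh hb P0 P1 pP]]]; exists h, Phi; split=> // f.
  by rewrite -e0.
by rewrite -e1.
Qed.

(** * Substitutions commuting with [mu_nb] *)

(* mu_nb-eigenvectors of weight w. *)
Definition homog_wt (w : nat) (g : B) : Prop :=
  forall p q, g@_(mk p q) != 0 -> q + na * p = w %[mod nb].

Lemma homog_wtM v w f g : homog_wt v f -> homog_wt w g -> homog_wt (v + w) (f * g).
Proof.
move=> hf hg p q; rewrite -mcoeff_msupp => /msuppM_le /allpairsP[[m m'] /=].
rewrite !mcoeff_msupp (mkE m) (mkE m') mkD => -[/hf h /hg h' /eqP].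
rewrite eq_mk => /andP[/eqP-> /eqP->].
by rewrite mulnDr addnACA -modnDm h h' modnDm.
Qed.

Lemma homog_wt1 : homog_wt 0 1.
Proof.
move=> p q; rewrite mcoeff1 -mk00 eq_mk.
have [<-|_] := eqVneq 0%N p; last by rewrite eqxx.
by have [<-|_] := eqVneq 0%N q; rewrite ?eqxx // muln0.
Qed.

Lemma homog_wtX w f k : homog_wt w f -> homog_wt (k * w) (f ^+ k).
Proof.
move=> h; elim: k => [|k IH]; first exact: homog_wt1.
by rewrite exprS mulSn; apply: homog_wtM.
Qed.

Lemma homog_wtD w f g : homog_wt w f -> homog_wt w g -> homog_wt w (f + g).
Proof.
move=> hf hg p q; rewrite mcoeffD.
have [e|/hf//] := eqVneq f@_(mk p q) 0; rewrite e add0r; exact: hg.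
Qed.

Lemma homog_wtZ w c f : homog_wt w f -> homog_wt w (c *: f).
Proof.
by move=> h p q; rewrite mcoeffZ mulf_eq0 => /norP[_]; apply: h.
Qed.

Lemma homog_wt0 w : homog_wt w 0.
Proof. by move=> p q; rewrite mcoeff0 eqxx. Qed.

Lemma homog_wt_mod v w f : v = w %[mod nb] -> homog_wt v f -> homog_wt w f.
Proof. by move=> e h p q /h; rewrite e. Qed.

Lemma iota_rho g : homog_wt 0 g -> iota (rho g) = g.
Proof.
move=> h; rewrite {1}[g]mpolyE [RHS]mpolyE !linear_sum /=.
rewrite big_seq [RHS]big_seq; apply: eq_bigr => m; rewrite mcoeff_msupp => hm.
rewrite !linearZ /= (mkE m) iota_rhoX /in_cone; rewrite (mkE m) in hm.
by have := h _ _ hm; rewrite mod0n /dvdn => ->.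
Qed.

Section Substitution.
Variables F G : B.
Hypotheses (hF : homog_wt na F) (hG : homog_wt 1 G).

Lemma comp2X p q : 'X_[mk p q] \mPo [tuple F; G] = F ^+ p * G ^+ q.
Proof.
by rewrite comp_mpolyX big_ord_recl big_ord1 mk0 -{2}(mk1 p q);
  congr (_ * _ ^+ mk _ _ _); apply: val_inj.
Qed.

Lemma homog_wt_comp f : homog_wt 0 (iota f \mPo [tuple F; G]).
Proof.
elim/span_ind: f => [|c f g h h'|p q Sp].
- by rewrite rmorph0 comp_mpoly0; apply: homog_wt0.
- rewrite linearP comp_mpolyD comp_mpolyZ.
  by apply: homog_wtD => //; apply: homog_wtZ.
rewrite iota_chi // comp2X.
apply: (@homog_wt_mod (p * na + q * 1)).
  by rewrite muln1 addnC mulnC mod0n; apply/eqP.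
by apply: homog_wtM; apply: homog_wtX.
Qed.

(** Since [F] and [G] carry the weights of [x] and [y], substituting them preserves invariance. *)
Lemma subst_subproof : {T : {lrmorphism A -> A} |
  forall f, iota (T f) = iota f \mPo [tuple F; G]}.
Proof.
pose T f := rho (iota f \mPo [tuple F; G]).
have iT f : iota (T f) = iota f \mPo [tuple F; G].
  by rewrite iota_rho //; apply: homog_wt_comp.
have lT : linear T.
  by move=> c f g; rewrite /T linearP comp_mpolyD comp_mpolyZ linearP.
have T1 : T 1 = 1 by apply: iota_inj; rewrite iT !rmorph1.
have TM : {morph T : f g / f * g}.
  by move=> f g; apply: iota_inj; rewrite iT !rmorphM /= !iT.
have [T' eT'] := lrmorphism_of lT T1 TM.
by exists T' => f; rewrite eT'.
Qed.

Definition subst : {lrmorphism A -> A} := sval subst_subproof.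

Lemma iota_subst f : iota (subst f) = iota f \mPo [tuple F; G].
Proof. exact: (svalP subst_subproof). Qed.

Lemma iota_subst_chi p q : S p q -> iota (subst (chi p q)) = F ^+ p * G ^+ q.
Proof. by move=> h; rewrite iota_subst iota_chi // comp2X. Qed.

End Substitution.

Lemma substK F G F' G' (hF : homog_wt na F) (hG : homog_wt 1 G)
    (hF' : homog_wt na F') (hG' : homog_wt 1 G') :
  F' \mPo [tuple F; G] = 'X_ord0 -> G' \mPo [tuple F; G] = 'X_ord_max ->
  cancel (subst hF' hG') (subst hF hG).
Proof.
move=> e e' f; apply: iota_inj; rewrite !iota_subst.
apply: (@lin_extB B (comp_mpoly [tuple F; G] \o comp_mpoly [tuple F'; G']) idfun).
move=> p q /=; rewrite comp2X rmorphM !rmorphXn /= e e' !mpolyXn -mpolyXD.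
by congr 'X_[_]; apply: mnm2P;
  rewrite mnmDE !mulmnE !mnm1E ?mk0 ?mk1 /= ?mul1n ?mul0n ?addn0.
Qed.

Section AffineSubstitutions.
Implicit Types x y e u v f : K.

Definition aff x y e : B := x *: 'X_ord0 + y *: 'X_ord_max + e%:MP.

(* The affine substitutions commuting with mu_nb. *)
Definition compatible y e u f : bool :=
  [|| nb == 1%N, [&& na == 1%N, e == 0 & f == 0]
    | [&& y == 0, e == 0, u == 0 & f == 0]].

Lemma mX0 : 'X_ord0 = 'X_[mk 1 0] :> B.
Proof. by congr 'X_[_]; apply: mnm2P; rewrite mnm1E ?mk0 ?mk1. Qed.

Lemma mX1 : 'X_ord_max = 'X_[mk 0 1] :> B.
Proof. by congr 'X_[_]; apply: mnm2P; rewrite mnm1E ?mk0 ?mk1. Qed.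

Lemma homog_wtXmk p q : homog_wt (q + na * p) 'X_[mk p q].
Proof.
move=> p' q'; rewrite mcoeffX eq_mk.
have [<-|_] := eqVneq p p'; last by rewrite eqxx.
by have [<-|_] := eqVneq q q'; rewrite ?eqxx.
Qed.

Lemma homog_wt_scaleX w c p q : (c == 0) || (q + na * p == w %[mod nb]) ->
  homog_wt w (c *: 'X_[mk p q]).
Proof.
case/orP => [/eqP->|/eqP h]; first by rewrite scale0r; apply: homog_wt0.
by apply: homog_wtZ; exact: (homog_wt_mod h (@homog_wtXmk p q)).
Qed.

Lemma mpolyC_mk e : e%:MP = e *: 'X_[mk 0 0] :> B.
Proof. by rewrite mk00 mpolyX0 alg_mpolyC. Qed.

Lemma homog_wt_aff0 x y e u f : compatible y e u f -> homog_wt na (aff x y e).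
Proof.
move=> h; rewrite /aff mpolyC_mk mX0 mX1; apply: homog_wtD.
  apply: homog_wtD; apply: homog_wt_scaleX; first by rewrite muln1 eqxx orbT.
  case/or3P: h => [/eqP->|/and3P[/eqP->]|/and4P[->]//]; rewrite ?modn1 ?orbT //.
  by rewrite muln0 eqxx orbT.
apply: homog_wt_scaleX.
by case/or3P: h => [/eqP->|/and3P[_ ->]|/and4P[_ ->]//]; rewrite ?modn1 ?orbT.
Qed.

Lemma homog_wt_aff1 u v y e f : compatible y e u f -> homog_wt 1 (aff u v f).
Proof.
move=> h; rewrite /aff mpolyC_mk mX0 mX1; apply: homog_wtD.
  apply: homog_wtD; apply: homog_wt_scaleX; last by rewrite muln0 eqxx orbT.
  case/or3P: h => [/eqP->|/and3P[/eqP->]|/and4P[_ _ ->]//]; rewrite ?modn1 ?orbT //.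
  by rewrite muln1 eqxx orbT.
apply: homog_wt_scaleX.
by case/or3P: h => [/eqP->|/and3P[_ _ ->]|/and4P[_ _ _ ->]//]; rewrite ?modn1 ?orbT.
Qed.

Definition affsubst x y e u v f (h : compatible y e u f) : {lrmorphism A -> A} :=
  subst (@homog_wt_aff0 x y e u f h) (@homog_wt_aff1 u v y e f h).

Lemma comp_aff x y e (F G : B) : aff x y e \mPo [tuple F; G] = x *: F + y *: G + e%:MP.
Proof.
rewrite /aff !comp_mpolyD !comp_mpolyZ comp_mpolyC mX0 mX1 !comp2X.
by rewrite !expr0 !expr1 mul1r mulr1.
Qed.

Lemma compatibleZ c y e u f e' f' : compatible y e u f ->
  (e == 0 -> f == 0 -> (e' == 0) && (f' == 0)) -> compatible (c * y) e' (c * u) f'.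
Proof.
case/or3P => [h _|/and3P[h1 h2 h3] /(_ h2 h3) h|
  /and4P[/eqP-> h1 /eqP-> h2] /(_ h1 h2)/andP[h h']].
- by rewrite /compatible h.
- by rewrite /compatible h1 h orbT.
- by rewrite /compatible mulr0 eqxx h h' !orbT.
Qed.

Lemma aff_ext x y e x' y' e' : x = x' -> y = y' -> e = e' -> aff x y e = aff x' y' e'.
Proof. by move=> -> -> ->. Qed.

Lemma aff_comb x y e x' y' e' a b c : a *: aff x y e + b *: aff x' y' e' + c%:MP =
  aff (a * x + b * x') (a * y + b * y') (a * e + b * e' + c).
Proof. by rewrite /aff -!mul_mpolyC !mpolyCD !mpolyCM; ring. Qed.

Lemma X0_aff : 'X_ord0 = aff 1 0 0.
Proof. by rewrite /aff scale1r scale0r mpolyC0 !addr0. Qed.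

Lemma X1_aff : 'X_ord_max = aff 0 1 0.
Proof. by rewrite /aff scale1r scale0r mpolyC0 add0r addr0. Qed.

Lemma affsubst_bij x y e u v f (h : compatible y e u f) :
  x * v - y * u != 0 -> bijective (affsubst x v h).
Proof.
move=> D0; pose D := x * v - y * u.
(* Cramer's rule: the inverse affine map, with linear part the adjugate matrix divided by [D]. *)
pose e' := - (v * e - y * f) / D; pose f' := (u * e - x * f) / D.
have h' : compatible ((- D^-1) * y) e' ((- D^-1) * u) f'.
  apply: compatibleZ h _ => /eqP he /eqP hf.
  by rewrite /e' /f' he hf !mulr0 subrr oppr0 !mul0r eqxx.
exists (affsubst (v / D) (x / D) h'); apply: substK; rewrite comp_aff aff_comb ?X0_aff ?X1_aff.
- by apply: aff_ext; rewrite /e' /f' /D; field.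
- by apply: aff_ext; rewrite /e' /f' /D; field.
- by apply: aff_ext; rewrite /e' /f' /D; field.
- by apply: aff_ext; rewrite /e' /f' /D; field.
Qed.

(** The segment from the identity to the given substitution. It stays compatible because [y], [e],
    [u], [f] are only scaled by [t], and its determinant is a polynomial in [t] that is nonzero at
    both ends. *)
Lemma affsubst_conn x y e u v f (h : compatible y e u f) :
  x * v - y * u != 0 -> conn idfun (affsubst x v h).
Proof.
move=> D0.
have ht t : compatible (t * y) (t * e) (t * u) (t * f).
  by apply: compatibleZ h _ => /eqP-> /eqP->; rewrite mulr0 eqxx.
pose T t := affsubst (1 - t + t * x) (1 - t + t * v) (ht t).
pose hp : {poly K} := (1 - 'X + 'X * x%:P) * (1 - 'X + 'X * v%:P)
   - ('X * y%:P) * ('X * u%:P).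
have hpE t : hp.[t] = (1 - t + t * x) * (1 - t + t * v) - t * y * (t * u).
  by rewrite /hp !hornerE.
exists hp, T; split.
- rewrite !hpE !mul0r !subr0 !addr0 mul1r oner_neq0; split=> //.
  by rewrite subrr !mul1r !add0r.
- by move=> t; rewrite hpE; apply: affsubst_bij.
- move=> g; apply: iota_inj; rewrite iota_subst /=.
  have -> : aff (1 - 0 + 0 * x) (0 * y) (0 * e) = 'X_ord0.
    by rewrite !mul0r subr0 addr0 -X0_aff.
  have -> : aff (0 * u) (1 - 0 + 0 * v) (0 * f) = 'X_ord_max.
    by rewrite !mul0r subr0 addr0 -X1_aff.
  rewrite -[RHS]comp_mpoly_id; congr (_ \mPo _); apply: eq_from_tnth => i.
  rewrite tnth_mktuple; case: i => -[|[|//]] hi; rewrite (tnth_nth 0) /=;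
    by congr 'X_ _; apply: val_inj.
- move=> g; apply: iota_inj; rewrite !iota_subst.
  by rewrite subrr !add0r !mul1r.
apply: polyfam_chi => p q Sp.
pose P : {poly B} := ('X_ord0)%:P + 'X * (aff (x - 1) y e)%:P.
pose Q : {poly B} := ('X_ord_max)%:P + 'X * (aff u (v - 1) f)%:P.
have PE t : P.[t%:MP] = aff (1 - t + t * x) (t * y) (t * e).
  rewrite /P !hornerE mul_mpolyC X0_aff.
  rewrite -(addr0 (_ + _)) -mpolyC0 -[X in X + _ + _]scale1r aff_comb.
  by apply: aff_ext; ring.
have QE t : Q.[t%:MP] = aff (t * u) (1 - t + t * v) (t * f).
  rewrite /Q !hornerE mul_mpolyC X1_aff.
  rewrite -(addr0 (_ + _)) -mpolyC0 -[X in X + _ + _]scale1r aff_comb.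
  by apply: aff_ext; ring.
(* [P] and [Q] are the images of [x] and [y] as polynomials in [t] over [B]; [rho] brings the
   coefficients of the product back to [A]. *)
exists (map_poly rho (P ^+ p * Q ^+ q)) => t.
have -> : T t (chi p q) = rho ((P ^+ p * Q ^+ q).[t%:MP]).
  rewrite -[LHS]iotaK; congr (rho _).
  rewrite (horner_monomial p q (PE t) (QE t)) /T /affsubst.
  exact: (iota_subst_chi _ _ Sp).
clearbody P Q.
set R := (P ^+ p * Q ^+ q).
rewrite [RHS](@horner_coef_wide _ (size R)) ?size_poly // horner_coef linear_sum.
apply: eq_bigr => i _ /=; rewrite coef_map_id0 ?linear0 //.
rewrite -rmorphXn /= mulrC mul_mpolyC linearZ /=.
by rewrite exprZn expr1n mulr_algr.
Qed.

End AffineSubstitutions.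

(** * Graded automorphisms *)

Definition homogeneous (d : nat) (f : A) : Prop :=
  forall p q, (p + q != d)%N -> cf f p q = 0.

Lemma homog_ind d (P : A -> Prop) :
  P 0 -> (forall c f g, P f -> P g -> P (c *: f + g)) ->
  (forall p q, S p q -> (p + q = d)%N -> P (chi p q)) ->
  forall f, homogeneous d f -> P f.
Proof.
move=> P0 PD PX f hf; rewrite (expand f) big_seq.
elim/big_rec: _ => // m g hm Pg; apply: PD => //; rewrite (mkE m).
move: hm; rewrite mcoeff_msupp => hm; rewrite (mkE m) in hm.
apply: PX; first by apply: contraT => /cf_out h; rewrite -/(cf f _ _) h eqxx in hm.
apply/eqP; apply: contraT => /hf h.
by rewrite -/(cf f _ _) h eqxx in hm.
Qed.

(** Sets [x = 1]. On homogeneous elements of a fixed degree this loses nothing and gives access to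
    divisibility in one variable. *)
Definition dehomogB (g : B) : {poly K} :=
  mmap (@polyC K) (fun i : 'I_2 => if i == ord0 then 1 else 'X) g.
Definition dehomog (f : A) : {poly K} := dehomogB (iota f).

Lemma dehomogBX p q : dehomogB 'X_[mk p q] = 'X^q.
Proof.
rewrite /dehomogB mmapX /mmap1 big_ord_recl big_ord1 mk0 eqxx expr1n mul1r.
by rewrite -[in RHS](mk1 p q); congr (_ ^+ mk _ _ _); apply: val_inj.
Qed.

Lemma dehomogBM f g : dehomogB (f * g) = dehomogB f * dehomogB g.
Proof. by rewrite /dehomogB rmorphM. Qed.
Lemma dehomogBP c f g : dehomogB (c *: f + g) = c *: dehomogB f + dehomogB g.
Proof. by rewrite /dehomogB mmapD mmapZ mul_polyC. Qed.
Lemma dehomogBXn f k : dehomogB (f ^+ k) = dehomogB f ^+ k.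
Proof. by rewrite /dehomogB rmorphXn. Qed.
Lemma dehomogB0 : dehomogB 0 = 0. Proof. by rewrite /dehomogB mmap0. Qed.

Lemma dehomogM f g : dehomog (f * g) = dehomog f * dehomog g.
Proof. by rewrite /dehomog rmorphM dehomogBM. Qed.
Lemma dehomogXn f k : dehomog (f ^+ k) = dehomog f ^+ k.
Proof. by rewrite /dehomog rmorphXn dehomogBXn. Qed.
Lemma dehomogP c f g : dehomog (c *: f + g) = c *: dehomog f + dehomog g.
Proof. by rewrite /dehomog linearP dehomogBP. Qed.
Lemma dehomog0 : dehomog 0 = 0. Proof. by rewrite /dehomog rmorph0 dehomogB0. Qed.
Lemma dehomogZ c f : dehomog (c *: f) = c *: dehomog f.
Proof. by rewrite -[c *: f]addr0 dehomogP dehomog0 addr0. Qed.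
Lemma dehomog_chi p q : S p q -> dehomog (chi p q) = 'X^q.
Proof. by move=> h; rewrite /dehomog iota_chi // dehomogBX. Qed.

Lemma coef_dehomog d f k : homogeneous d f ->
  (dehomog f)`_k = if (k <= d)%N then cf f (d - k) k else 0.
Proof.
move: f; apply: homog_ind => [|c f g h h'|p q Sp e].
- by rewrite dehomog0 coef0 cf0 if_same.
- rewrite dehomogP coefD coefZ h h' cfD cfZ.
  by case: ifP => // _; rewrite mulr0 addr0.
rewrite dehomog_chi // coefXn cf_chi // -e.
have [->|h] := eqVneq q k.
  by rewrite leq_addl addnK eqxx.
by rewrite andbF if_same.
Qed.

Lemma size_dehomog d f : homogeneous d f -> (size (dehomog f) <= d.+1)%N.
Proof.
move=> h; apply/leq_sizeP => j hj; rewrite (coef_dehomog _ h) ifF //.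
by rewrite leqNgt hj.
Qed.

Lemma dehomog_inj d f g : homogeneous d f -> homogeneous d g -> dehomog f = dehomog g -> f = g.
Proof.
move=> hf hg e; apply: cf_ext => p q _.
have [h|h] := eqVneq (p + q)%N d; last by rewrite hf ?hg.
have := coef_dehomog q hf; rewrite e (coef_dehomog q hg) -h leq_addl addnK.
by move=> ->.
Qed.

Lemma homogZ d c f : homogeneous d f -> homogeneous d (c *: f).
Proof. by move=> h p q hpq; rewrite cfZ h // mulr0. Qed.

Lemma homog_chi p q : S p q -> homogeneous (p + q) (chi p q).
Proof.
move=> Sp p' q'; rewrite cf_chi //.
by have [<-|//] := eqVneq p p'; have [<-|//] := eqVneq q q'; rewrite eqxx.
Qed.

Lemma scale_chi_eq c c' p q p' q' : S p q -> S p' q' -> c != 0 ->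
  c *: chi p q = c' *: chi p' q' -> [/\ c = c', p = p' & q = q'].
Proof.
move=> Sp Sp' c0 e; have := congr1 (fun f => cf f p q) e.
rewrite !cfZ !cf_chi // !eqxx mulr1.
have [->|_] := eqVneq p' p; have [->|_] := eqVneq q' q;
  rewrite ?mulr0 ?mulr1 // => h; by rewrite h eqxx in c0.
Qed.

(** At [x = 1] the divisor becomes a divisor of a power of ['X], hence a scalar times such a
    power. *)
Lemma homog_divides_chi d f h s t : homogeneous d f -> S s t -> f * h = chi s t ->
  exists c k, [/\ c != 0, (k <= d)%N, S (d - k) k & f = c *: chi (d - k) k].
Proof.
move=> hf Ss e.
have : dehomog f %| ('X - 0%:P) ^+ t.
  by rewrite subr0 -(dehomog_chi Ss) -e dehomogM dvdp_mulr.
case/dvdp_exp_XsubCP => k _; rewrite subr0 => /eqpf_eq[c c0 ef].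
have kd : (k <= d)%N.
  by have := size_dehomog hf; rewrite ef size_scale // size_polyXn.
have Sk : S (d - k) k.
  apply: contraT => /(cf_out f) h0.
  have := coef_dehomog k hf; rewrite kd h0 ef coefZ coefXn eqxx mulr1 => h1.
  by rewrite h1 eqxx in c0.
exists c, k; split=> //; apply: (dehomog_inj hf).
  by apply: homogZ; have := homog_chi Sk; rewrite subnK.
by rewrite ef dehomogZ dehomog_chi.
Qed.

(** * Graded automorphisms when [1 < na < nb] *)

Definition graded (psi : A -> A) : Prop :=
  forall p q, S p q -> homogeneous (p + q) (psi (chi p q)).

Section MonomialCase.
Variables psi psi' : {lrmorphism A -> A}.
Hypotheses (psiK : cancel psi psi') (psi'K : cancel psi' psi).
Hypotheses (gpsi : graded psi) (gpsi' : graded psi').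
Hypothesis (na_gt1 : (1 < na)%N) (na_lt : (na < nb)%N).
Let q1 := (nb - na)%N.

(** Pure powers of [x] or [y] are invariant only if [nb] divides their exponent, by coprimality,
    whereas [0 < 1 + q1 < nb] because [1 < na < nb]. *)
Lemma deg_interior p q : S p q -> (p + q = 1 + q1)%N -> (0 < p)%N && (0 < q)%N.
Proof.
rewrite /in_cone => Sp e.
have e1 : (p + q < nb)%N by rewrite e /q1; lia.
have e0 : (0 < p + q)%N by rewrite e.
case: (posnP p) => [p0|_].
  by move: Sp; rewrite p0 muln0 addn0 gtnNdvd //; lia.
case: (posnP q) => [q0|//]; move: Sp; rewrite q0 add0n mulnC Gauss_dvdl.
  by rewrite gtnNdvd //; lia.
by rewrite coprime_sym.
Qed.

(** By [deg_interior], [x^s y^t] divides [g] in [B]; the [nb]-th power of the quotient is paired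
    with the invariant monomial and projected to [A]. *)
Lemma pow_divisible s t g : homogeneous (1 + q1) g -> (s <= 1)%N -> (t <= 1)%N ->
  S (nb * s) (nb * t) -> exists h, g ^+ nb = chi (nb * s) (nb * t) * h.
Proof.
move=> hg s1 t1 Ss.
have [g1 eg] : exists g1, iota g = 'X_[mk s t] * g1.
  move: g hg; apply: homog_ind => [|c f g [f1 h] [g1 h']|p q Sp /(deg_interior Sp) h].
  - by exists 0; rewrite rmorph0 mulr0.
  - by exists (c *: f1 + g1); rewrite linearP /= h h' mulrDr scalerAr.
  exists 'X_[mk (p - s) (q - t)]; rewrite iota_chi // -mpolyXD mkD.
  by rewrite !subnKC //; lia.
exists (rho (g1 ^+ nb)); rewrite -rho_iotaM iota_chi // -[LHS]iotaK rmorphXn /=.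
rewrite eg exprMn mpolyXn; congr (rho ('X_[_] * _)).
by apply: mnm2P; rewrite mulmnE ?mk0 ?mk1 mulnC.
Qed.

(* chi 1 q1 ^+ nb is divisible by the image of each ray generator, and divisors
   of monomials are monomials. *)
Lemma psi_ray s t : (s <= 1)%N -> (t <= 1)%N -> (s + t = 1)%N ->
  S (nb * s) (nb * t) ->
  exists c k, [/\ c != 0, (k <= nb)%N, S (nb - k) k &
    psi (chi (nb * s) (nb * t)) = c *: chi (nb - k) k].
Proof.
move=> s1 t1 st Ss; have S1 := in_cone_1 na_le.
have hg : homogeneous (1 + q1) (psi' (chi 1 q1)) by apply: gpsi'.
have [h eh] := pow_divisible hg s1 t1 Ss.
have hd : homogeneous nb (psi (chi (nb * s) (nb * t))).
  by have := gpsi Ss; rewrite -mulnDr st muln1.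
have [e2 S2] := chiX nb S1.
apply: (homog_divides_chi hd S2 (h := psi h)).
by rewrite -rmorphM -eh rmorphXn /= psi'K.
Qed.

(** Here [i] and [j] are the [x]-exponents of the images of [x^nb] and [y^nb]. The [nb]-th power of
    a monomial is a product of these two, so the image of the monomial divides a monomial and is
    one; comparing [nb]-th powers gives the exponents. *)
Lemma psi_monomial : exists i j, [/\ (i <= nb)%N, (j <= nb)%N & forall p q, S p q ->
  exists c p' q', [/\ c != 0, S p' q', psi (chi p q) = c *: chi p' q',
    (nb * p' = p * i + q * j)%N & (nb * q' = p * (nb - i) + q * (nb - j))%N]].
Proof.
have Sb0 := in_cone_b0 na nb; have S0b := in_cone_0b na nb.
have := @psi_ray 1 0 isT isT erefl; rewrite muln1 muln0.
move=> /(_ Sb0)[x [k [x0 kb Sk ek]]].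
have := @psi_ray 0 1 isT isT erefl; rewrite muln1 muln0.
move=> /(_ S0b)[y [l [y0 lb Sl el]]].
exists (nb - k)%N, (nb - l)%N; split; rewrite ?leq_subr // => p q Sp.
have [e1 S1] := chiX nb Sp.
have [e2 S2] := chiX p Sb0.
have [e3 S3] := chiX q S0b.
have [e4 S4] := chiX p Sk.
have [e5 S5] := chiX q Sl.
have epow : psi (chi p q) ^+ nb = (x ^+ p * y ^+ q) *:
    chi (p * (nb - k) + q * (nb - l)) (p * k + q * l).
  rewrite -rmorphXn e1.
  have -> : chi (nb * p) (nb * q) = chi nb 0 ^+ p * chi 0 nb ^+ q.
    by rewrite e2 e3 chiM // !muln0 addn0 add0n; congr (chi _ _); rewrite mulnC.
  rewrite rmorphM !rmorphXn /= ek el !exprZn e4 e5 -scalerAl -scalerAr chiM //.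
  by rewrite scalerA.
have xy0 : x ^+ p * y ^+ q != 0 by rewrite mulf_neq0 ?expf_neq0.
have S6 := in_coneD S5 S4.
have [c [m [c0 mb Sm em]]] : exists c m,
  [/\ c != 0, (m <= p + q)%N, S (p + q - m) m & psi (chi p q) = c *: chi (p + q - m) m].
  apply: (homog_divides_chi (gpsi Sp) S6
    (h := (x ^+ p * y ^+ q)^-1 *: psi (chi p q) ^+ nb.-1)).
  by rewrite -scalerAr -exprS prednK // epow scalerA mulVf // scale1r.
have [e7 S7] := chiX nb Sm.
exists c, (p + q - m)%N, m; split=> //.
  move: epow; rewrite em exprZn e7 => /scale_chi_eq => /(_ S7 S6).
  by rewrite expf_neq0 // => /(_ isT)[_ -> _].
move: epow; rewrite em exprZn e7 => /scale_chi_eq => /(_ S7 S6).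
by rewrite expf_neq0 // !subKn // => /(_ isT)[_ _ ->].
Qed.

End MonomialCase.

Lemma scaled_chi_inv (psi psi' : {lrmorphism A -> A}) c p q p' q' :
  cancel psi psi' -> c != 0 -> psi (chi p q) = c *: chi p' q' ->
  psi' (chi p' q') = c^-1 *: chi p q.
Proof.
move=> psiK c0 e; rewrite -[chi p q]psiK e linearZ /= scalerA mulVf //.
by rewrite scale1r.
Qed.

Definition flip (b : bool) (p q : nat) : nat * nat := if b then (q, p) else (p, q).

(** As the inverse is monomial too, the induced map on exponents reaches both corners [(nb, 0)] and
    [(0, nb)] in degree [nb]. This forces [(i, j)] to be [(nb, 0)] or [(0, nb)], the latter being
    the exchange. *)
Lemma graded_monomial (psi psi' : {lrmorphism A -> A}) :
    cancel psi psi' -> cancel psi' psi -> graded psi -> graded psi' ->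
    (1 < na < nb)%N ->
  exists b, forall p q, S p q -> S (flip b p q).1 (flip b p q).2 /\
    exists2 c, c != 0 & psi (chi p q) = c *: chi (flip b p q).1 (flip b p q).2.
Proof.
move=> psiK psi'K gpsi gpsi' /andP[na1 nab].
have [i [j [ib jb H]]] := psi_monomial psi'K gpsi gpsi' na1 nab.
have [i' [j' [ib' jb' H']]] := psi_monomial psiK gpsi' gpsi na1 nab.
have Sb0 := in_cone_b0 na nb; have S0b := in_cone_0b na nb.
have onto s t : S s t -> (s + t = nb)%N -> exists p q, [/\ (p + q = nb)%N,
    (nb * s = p * i + q * j)%N & (nb * t = p * (nb - i) + q * (nb - j))%N].
  move=> Ss st; have [c' [p [q [c'0 Sp e' _ _]]]] := H' _ _ Ss.
  have [c [s' [t' [c0 Ss' e e1 e2]]]] := H _ _ Sp.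
  have [_ es et] : [/\ c = c'^-1, s' = s & t' = t].
    apply: scale_chi_eq => //; rewrite -e.
    exact: scaled_chi_inv psi'K c'0 e'.
  exists p, q; rewrite -es -et; split=> //.
  have /eqP : (nb * (s' + t') = nb * (p + q))%N.
    rewrite mulnDr e1 e2 addnACA -!mulnDr !subnKC //.
    by rewrite -mulnDl mulnC.
  by rewrite eqn_pmul2l // es et st => /eqP.
have [p [q [pq _ e1]]] := onto nb 0%N Sb0 (addn0 _).
have [p' [q' [pq' e2 _]]] := onto 0%N nb S0b (add0n _).
have ij : (i = nb /\ j = 0%N) \/ (i = 0%N /\ j = nb).
  move/eqP: e1; rewrite muln0 eq_sym addn_eq0 !muln_eq0 => /andP[h1 h2].
  move/eqP: e2; rewrite muln0 eq_sym addn_eq0 !muln_eq0 => /andP[h3 h4].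
  by lia.
exists (i == 0%N) => p0 q0 Sp; have [c [s [t [c0 Ss e e3 e4]]]] := H _ _ Sp.
suff [es et] : s = (flip (i == 0%N) p0 q0).1 /\ t = (flip (i == 0%N) p0 q0).2.
  by rewrite -es -et; split=> //; exists c.
case: ij => -[ei ej]; rewrite ei ej ?subnn ?subn0 ?muln0 ?addn0 ?add0n in e3 e4 *.
  rewrite gtn_eqF //=; split; apply/eqP.
    by rewrite -(eqn_pmul2l nb_gt0) e3 mulnC.
  by rewrite -(eqn_pmul2l nb_gt0) e4 mulnC.
rewrite eqxx /=; split; apply/eqP.
  by rewrite -(eqn_pmul2l nb_gt0) e3 mulnC.
by rewrite -(eqn_pmul2l nb_gt0) e4 mulnC.
Qed.

Lemma lrmorphism_ext (f g : {lrmorphism A -> A}) :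
  (forall p q, S p q -> f (chi p q) = g (chi p q)) -> f =1 g.
Proof. exact: lin_ext. Qed.

Lemma nth_root (n : nat) (c : K) : (0 < n)%N -> exists x, x ^+ n = c.
Proof.
move=> n0.
have [x ex] := @GRing.solve_monicpoly K n (fun i => if i == 0%N then c else 0) n0.
exists x; rewrite ex -(prednK n0) big_ord_recl /= expr0 mulr1 big1 ?addr0 //.
by move=> i _; rewrite mul0r.
Qed.

(** [psi] is the substitution [(x, y) |-> (u x, v y)], with [v] an [nb]-th root of the eigenvalue of
    [y^nb] and [u] adjusted to the eigenvalue of [x y^q1]. *)
Lemma conn_torus (psi : {lrmorphism A -> A}) : (na < nb)%N ->
  (forall p q, S p q -> exists2 c, c != 0 & psi (chi p q) = c *: chi p q) ->
  conn idfun psi.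
Proof.
move=> nab H; pose q1 := (nb - na)%N.
have S1 : S 1 q1 := in_cone_1 na_le; have S0b := in_cone_0b na nb.
have [x x0 ex] := H _ _ S1; have [y y0 ey] := H _ _ S0b.
have [v ev] := nth_root y nb_gt0.
have v0 : v != 0 by apply: contraNneq y0 => e; rewrite -ev e expr0n gtn_eqF.
pose u := x / v ^+ q1.
have u0 : u != 0 by rewrite mulf_neq0 // invr_eq0 expf_neq0.
have hc : compatible (0 : K) 0 0 0 by rewrite /compatible eqxx !orbT.
have det0 : u * v - 0 * 0 != 0 by rewrite mulr0 subr0 mulf_neq0.
have := affsubst_conn hc det0; apply: conn_eq => //.
apply: lrmorphism_ext => p q Sp.
apply: iota_inj; rewrite iota_subst_chi // /aff !scale0r mpolyC0 !addr0 add0r.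
have [c c0 ec] := H _ _ Sp; rewrite ec linearZ /= iota_chi //.
rewrite !exprZn mX0 mX1 !mpolyXn -scalerAl -scalerAr -mpolyXD scalerA.
have -> : (mk 1 0 *+ p + mk 0 1 *+ q)%MM = mk p q.
  by apply: mnm2P; rewrite mnmDE !mulmnE !(mk0, mk1) ?mul1n ?mul0n ?addn0.
congr (_ *: _); have [k ek] := dvdnP Sp.
have q10 : (0 < q1)%N by rewrite subn_gt0.
(* After multiplication by a power of [y^nb], every monomial of [A] is a product of powers of
   [x y^q1] and [y^nb]; hence these two eigenvalues determine all others. *)
pose N := (p * q1)%N; pose N' := (k + (p * q1 - p))%N.
have eN : (q + N * nb = p * q1 + N' * nb)%N.
  have h1 : (p <= p * q1)%N by rewrite leq_pmulr.
  have h2 : (p * q1 + na * p = nb * p)%N by rewrite mulnC -mulnDl subnK.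
  rewrite /N /N' mulnDl mulnBl -ek [(p * nb)%N]mulnC -h2.
  have h3 : (nb * p <= p * q1 * nb)%N by rewrite mulnC leq_mul2r h1 orbT.
  by lia.
have [e1 S1'] := chiX p S1; have [e2 S2'] := chiX N S0b; have [e3 S3'] := chiX N' S0b.
have key : chi p q * chi 0 nb ^+ N = chi 1 q1 ^+ p * chi 0 nb ^+ N'.
  rewrite e1 e2 e3 !chiM // !muln0 !muln1 addn0; congr (chi _ _).
  by rewrite ?addn0 eN.
have := congr1 psi key; rewrite !rmorphM !rmorphXn /= ec ex ey !exprZn.
rewrite -!scalerAl -!scalerAr key !scalerA e1 e3 chiM // => /scale_chi_eq.
move=> /(_ (in_coneD S3' S1') (in_coneD S3' S1')).
rewrite mulf_neq0 ?expf_neq0 // => /(_ isT)[h _ _].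
have vN0 : v ^+ (N * nb) != 0 by rewrite expf_neq0.
have hv m : v ^+ (m * nb) = y ^+ m by rewrite mulnC exprM ev.
have e : u ^+ p * v ^+ (p * q1) = x ^+ p.
  by rewrite /u exprMn exprVn -exprM [(q1 * p)%N]mulnC divfK // expf_neq0.
apply: (mulIf vN0); rewrite -mulrA -exprD eN exprD mulrA e !hv.
by rewrite mulrC h mulrC.
Qed.

(** * Graded automorphisms when [na = 1] or [nb = 1] *)

Section LinearCase.
Variables psi psi' : {lrmorphism A -> A}.
Hypotheses (psiK : cancel psi psi') (gpsi : graded psi).
Hypothesis na_nb1 : (na == 1%N) || (nb == 1%N).

Lemma in_cone_linear p q : S p q = (nb %| p + q)%N.
Proof.
rewrite /in_cone; case/orP: na_nb1 => /eqP->; first by rewrite mul1n addnC.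
by rewrite !dvd1n.
Qed.

(** The Veronese ring is generated by its monomials of degree [nb]. *)
Lemma linear_generators (f g : {lrmorphism A -> A}) :
  (forall i, (i <= nb)%N -> f (chi (nb - i) i) = g (chi (nb - i) i)) -> f =1 g.
Proof.
move=> H; apply: lrmorphism_ext => p q; rewrite in_cone_linear => /dvdnP[k].
elim: k p q => [|k IH] p q e.
  move/eqP: e; rewrite mul0n addn_eq0 => /andP[/eqP-> /eqP->].
  by rewrite chi00 !rmorph1.
pose i := minn q nb.
have ib : (i <= nb)%N by rewrite geq_minr.
have iq : (i <= q)%N by rewrite geq_minl.
have pi : (nb - i <= p)%N by rewrite /i; rewrite mulSn in e; lia.
have e' : (p - (nb - i) + (q - i) = k * nb)%N by rewrite mulSn in e; lia.
have -> : chi p q = chi (nb - i) i * chi (p - (nb - i)) (q - i).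
  rewrite chiM ?in_cone_linear ?e' ?dvdn_mull ?subnK //.
  by rewrite !subnKC.
by rewrite !rmorphM /= H // IH.
Qed.

(* With f_i the image of x^(nb-i) y^i, the relations f_i f_0^(i-1) = f_1^i give
   f_i = w P^(nb-i) Q^i for P/Q = f_0/f_1 in lowest terms, and w is a constant
   for degree reasons. *)
Lemma binary_form_powers : exists x y u v : K, x * v - y * u != 0 /\
  forall i, (i <= nb)%N ->
    dehomog (psi (chi (nb - i) i)) = (x%:P + y *: 'X) ^+ (nb - i) * (u%:P + v *: 'X) ^+ i.
Proof.
have Si i : (i <= nb)%N -> S (nb - i) i by move=> h; rewrite in_cone_linear subnK.
pose F i := dehomog (psi (chi (nb - i) i)).
have hF i : (i <= nb)%N -> homogeneous nb (psi (chi (nb - i) i)).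
  by move=> h; have := gpsi (Si i h); rewrite subnK.
have indep c c' : c *: F 0 + c' *: F 1 = 0 -> c = 0 /\ c' = 0.
  rewrite /F -[c' *: dehomog _]dehomogZ -dehomogP => e.
  have : psi (c *: chi (nb - 0) 0 + c' *: chi (nb - 1) 1) = 0.
    apply: (@dehomog_inj nb); last by rewrite dehomog0 linearP /= linearZ.
      move=> p q hpq; rewrite linearP /= linearZ /= cfD !cfZ !hF //.
      by rewrite !mulr0 addr0.
    by move=> p q _; rewrite cf0.
  rewrite -(rmorph0 psi) => /(can_inj psiK) /(congr1 (fun f => (cf f nb 0, cf f (nb - 1) 1))).
  rewrite !(cfD, cfZ, cf0) !cf_chi ?Si // subn0 !eqxx /= !andbF !mulr0 !mulr1.
  by rewrite addr0 add0r => -[].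
have F0 : F 0 != 0.
  apply/eqP => e; have [|/eqP] := indep 1 0.
    by rewrite e scaler0 scale0r addr0.
  by rewrite oner_eq0.
have FX i : (0 < i <= nb)%N -> F i * F 0 ^+ i.-1 = F 1 ^+ i.
  case: i => [//|i] /= ib; rewrite /F -!dehomogXn -dehomogM -!rmorphXn -rmorphM /=.
  have [e1 S1] := chiX i (Si 0 isT); have [e2 S2] := chiX i.+1 (Si 1 nb_gt0).
  rewrite e1 e2 chiM ?Si //; congr (dehomog (psi (chi _ _))); last by lia.
  by rewrite subn0 mulnBr muln1 mulSn; lia.
pose g := gcdp (F 0) (F 1).
have g0 : g != 0 by rewrite gcdp_eq0 (negbTE F0).
pose P : {poly K} := F 0 %/ g; pose Q : {poly K} := F 1 %/ g.
have eP : F 0 = P * g by rewrite divpK // dvdp_gcdl.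
have eQ : F 1 = Q * g by rewrite divpK // dvdp_gcdr.
have PQ : coprimep P Q by apply: coprimep_div_gcd; rewrite F0.
have P0 : P != 0 by apply: contraNneq F0 => e; rewrite eP e mul0r.
have eb : F nb * P ^+ nb.-1 = Q ^+ nb * g.
  apply: (mulIf (expf_neq0 nb.-1 g0)); rewrite -mulrA -exprMn -eP.
  by rewrite FX ?nb_gt0 ?leqnn // eQ exprMn -mulrA -exprS prednK.
(* In [eb] the factor [P ^+ nb.-1] is coprime to [Q ^+ nb], so it divides [g]. *)
have [w ew] : exists w : {poly K}, g = w * P ^+ nb.-1.
  apply/dvdpP.
  have h : P ^+ nb.-1 %| Q ^+ nb * g by rewrite -eb dvdp_mull.
  by rewrite Gauss_dvdpr // in h; apply: coprimep_expl; apply: coprimep_expr.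
have w0 : w != 0 by apply: contraNneq g0 => e; rewrite ew e mul0r.
have PX0 k : P ^+ k != 0 by rewrite expf_neq0.
have eF i : (i <= nb)%N -> F i = w * P ^+ (nb - i) * Q ^+ i.
  case: i => [_|i ib].
    by rewrite subn0 expr0 mulr1 eP ew mulrC -mulrA -exprSr prednK.
  have := FX i.+1; rewrite ib => /(_ isT) /=; rewrite eP eQ ew => e.
  have h : (P * (w * P ^+ nb.-1)) ^+ i != 0.
    by rewrite expf_neq0 // !mulf_neq0.
  apply: (mulIf h); rewrite e.
  have -> : P * (w * P ^+ nb.-1) = w * P ^+ nb.
    by rewrite mulrCA -exprS prednK.
  rewrite !exprMn -!exprM.
  have -> : (nb.-1 * i.+1 = (nb - i.+1) + nb * i)%N.
    by rewrite -subn1 mulnBl mul1n mulnS; have := leq_pmulr i nb_gt0; nia.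
  by rewrite exprD !exprS; ring.
have szF i : (i <= nb)%N -> (size (F i) <= nb.+1)%N.
  by move=> h; apply: size_dehomog (hF i h).
(* The degree of [w * R ^+ nb] is at most [nb]: so [R] is at most linear, and [w] is constant once
   [R] is not. *)
have szX (R : {poly K}) : (size (w * R ^+ nb)%R <= nb.+1)%N -> R != 0 ->
    (size R <= 2)%N /\ ((1 < size R)%N -> size w = 1%N).
  move=> h R0; rewrite size_mul ?expf_neq0 // in h.
  have := size_exp R nb; rewrite -size_poly_gt0 in w0; rewrite -size_poly_gt0 in R0.
  have : (0 < size (R ^+ nb))%N by rewrite size_poly_gt0 expf_neq0 // -size_poly_gt0.
  move: h R0 w0; move: (size (R ^+ nb)) (size R) (size w) => a b c.
  by move=> h b0 c0 a0 e; split=> [|b1]; nia.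
have [szP wP] : (size P <= 2)%N /\ ((1 < size P)%N -> size w = 1%N).
  by apply: szX => //; have := szF 0 isT; rewrite eF // subn0 expr0 mulr1.
have [szQ wQ] : (size Q <= 2)%N /\ ((1 < size Q)%N -> size w = 1%N).
  have [->|Q0] := eqVneq Q 0; first by rewrite size_poly0.
  by apply: szX => //; have := szF nb (leqnn _); rewrite eF // subnn expr0 mulr1.
have sz_lin (R : {poly K}) : (size R <= 2)%N -> R = (R`_0)%:P + R`_1 *: 'X.
  move=> h; apply/polyP => k; rewrite coefD coefC coefZ coefX.
  case: k => [|[|k]] /=; rewrite ?mulr0 ?mulr1 ?addr0 ?add0r //.
  by rewrite nth_default //; apply: leq_trans h _.
have indPQ c c' : c *: P + c' *: Q = 0 -> c = 0 /\ c' = 0.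
  move=> e; apply: indep; rewrite eP eQ !scalerAl -mulrDl e mul0r //.
have w1 : size w = 1%N.
  (* If [P] and [Q] were both constant they would be proportional, contradicting the injectivity of
     [psi]. *)
  case: (ltnP 1 (size P)) => [/wP//|h]; case: (ltnP 1 (size Q)) => [/wQ//|h'].
  have eP' := size1_polyC h; have eQ' := size1_polyC h'.
  have [h1 h2] : Q`_0 = 0 /\ - P`_0 = 0.
    apply: indPQ; rewrite eP' eQ' !coefC !eqxx -!mul_polyC -!polyCM.
    by rewrite mulNr polyCN mulrC subrr.
  by move/eqP: h2; rewrite oppr_eq0 => /eqP h2; rewrite eP' h2 eqxx in P0.
have /size_poly1P[c c0 ec] : size w == 1%N by rewrite w1.
(* The constant [w = c] is absorbed into both linear forms through an [nb]-th root [s]. *)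
have [s es] := nth_root c nb_gt0.
have s0 : s != 0 by apply: contraNneq c0 => e; rewrite -es e expr0n gtn_eqF.
exists (s * P`_0), (s * P`_1), (s * Q`_0), (s * Q`_1); split.
  have -> : s * P`_0 * (s * Q`_1) - s * P`_1 * (s * Q`_0) =
    s ^+ 2 * (P`_0 * Q`_1 - P`_1 * Q`_0) by ring.
  rewrite mulf_neq0 ?expf_neq0 //; apply/eqP => e.
  have d1 : Q`_1 *: P + (- P`_1) *: Q = 0.
    rewrite [P in Q`_1 *: P](sz_lin P) // [Q in _ + _ *: Q](sz_lin Q) //.
    rewrite !scalerDr !scalerA addrACA -scalerDl -!mul_polyC -!polyCM -polyCD.
    have -> : Q`_1 * P`_0 + - P`_1 * Q`_0 = 0 by rewrite -[RHS]e; ring.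
    have -> : Q`_1 * P`_1 + - P`_1 * Q`_1 = 0 by ring.
    by rewrite polyC0 mul0r addr0.
  have d2 : Q`_0 *: P + (- P`_0) *: Q = 0.
    rewrite [P in Q`_0 *: P](sz_lin P) // [Q in _ + _ *: Q](sz_lin Q) //.
    rewrite !scalerDr !scalerA addrACA -scalerDl -!mul_polyC -!polyCM -polyCD.
    have -> : Q`_0 * P`_0 + - P`_0 * Q`_0 = 0 by ring.
    have -> : Q`_0 * P`_1 + - P`_0 * Q`_1 = 0.
      by apply: oppr_inj; rewrite oppr0 -[RHS]e; ring.
    by rewrite polyC0 mul0r addr0.
  have [_ /eqP] := indPQ _ _ d1; have [_ /eqP] := indPQ _ _ d2.
  rewrite !oppr_eq0 => /eqP h1 /eqP h2.
  by rewrite (sz_lin P szP) h1 h2 scale0r addr0 eqxx in P0.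
move=> i ib; rewrite -/(F i) eF // ec -es.
have sc (R : {poly K}) : (size R <= 2)%N -> (s * R`_0)%:P + (s * R`_1) *: 'X = s%:P * R.
  move=> h; rewrite [in RHS](sz_lin R h) mulrDr -polyCM; congr (_ + _).
  by rewrite -scalerA mul_polyC.
rewrite !sc // !exprMn -{1}(subnK ib) exprD polyCM -!rmorphXn /=; ring.
Qed.

Lemma conn_linear : conn idfun psi.
Proof.
have [x [y [u [v [det0 H]]]]] := binary_form_powers.
have hc : compatible y 0 u 0.
  rewrite /compatible eqxx !andbT; case/orP: na_nb1 => /eqP->; rewrite eqxx ?orbT //.
have := affsubst_conn hc det0; apply: conn_eq => //.
apply: linear_generators => i ib.
have Si : S (nb - i) i by rewrite in_cone_linear subnK.
apply: (@dehomog_inj nb); last 1 first.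
- rewrite H // /dehomog iota_subst_chi // dehomogBM !dehomogBXn.
  have da s t : dehomogB (aff s t 0) = s%:P + t *: 'X.
    rewrite /aff mpolyC0 addr0 dehomogBP -[t *: 'X_ord_max]addr0 dehomogBP dehomogB0 addr0.
    by rewrite mX0 mX1 !dehomogBX expr0 expr1 alg_polyC.
  by rewrite !da.
- have ha s t : aff s t 0 \is 1.-homog.
    by rewrite /aff mpolyC0 addr0 mX0 mX1 dhomogD // dhomogZ // dhomogX /= mdeg_mk.
  move=> p q hpq; rewrite /cf iota_subst_chi //.
  have hd := dhomogM (dhomogMn (nb - i) (ha x y)) (dhomogMn i (ha u v)).
  rewrite !mul1n subnK // in hd.
  by apply: (dhomog_nemf_coeff hd); rewrite /= mdeg_mk.
by have := gpsi Si; rewrite subnK.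
Qed.

End LinearCase.

Lemma degeneration_graded (phi gphi : {lrmorphism A -> A}) :
  (forall p q p' q', S p q -> cf (gphi (chi p q)) p' q' =
    if (p' + q' == p + q)%N then cf (phi (chi p q)) p' q' else 0) -> graded gphi.
Proof. by move=> h p q Sp p' q' hpq; rewrite h // (negbTE hpq). Qed.

Lemma conn_linear_case (phi phi' : {lrmorphism A -> A}) :
  (na == 1%N) || (nb == 1%N) -> cancel phi phi' -> cancel phi' phi ->
  (forall f, eps (phi f) = eps f) -> conn idfun phi.
Proof.
move=> h1 phiK phi'K ephi.
have ephi' f : eps (phi' f) = eps f by rewrite -ephi phi'K.
have F : filtered phi by move=> *; apply: (aut_filtered phiK phi'K ephi).
have F' : filtered phi' by move=> *; apply: (aut_filtered phi'K phiK ephi').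
have [g [g' [gK g'K cg h h']]] := degeneration F F' phiK phi'K.
by apply: conn_trans cg; apply: conn_linear gK (degeneration_graded h) h1.
Qed.

Lemma eps_chi_morph (f : {lrmorphism A -> A}) p q : nb = 1%N ->
  eps (f (chi p q)) = eps (f (chi 1 0)) ^+ p * eps (f (chi 0 1)) ^+ q.
Proof.
move=> nb1; have Sall s t : S s t by rewrite /in_cone nb1 dvd1n.
have epsX g k : eps (g ^+ k) = eps g ^+ k.
  elim: k => [|k IH]; last by rewrite !exprS epsM IH.
  by rewrite !expr0 -chi00 /eps cf_chi.
have [e1 _] := chiX p (Sall 1 0)%N; have [e2 _] := chiX q (Sall 0 1)%N.
rewrite -!epsX -epsM -!rmorphXn -rmorphM e1 e2 chiM ?Sall //.
by rewrite !muln0 !muln1 addn0 add0n.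
Qed.

Lemma conn_id_all (phi phi' : {lrmorphism A -> A}) :
  (na == 1%N) || (nb == 1%N) -> cancel phi phi' -> cancel phi' phi ->
  conn idfun phi.
Proof.
move=> h1 phiK phi'K.
case: (ltnP 1 nb) => [nb1|nb1].
  exact: (conn_linear_case h1 phiK phi'K (aut_eps nb1 phiK phi'K)).
(* On the plane the origin may move. The translation [T] with the same effect on it is split off,
   and [phi \o T'] then fixes the origin. *)
have nb1' : nb = 1%N by apply/eqP; rewrite eqn_leq nb1.
have Sall s t : S s t by rewrite /in_cone nb1' dvd1n.
pose e := eps (phi (chi 1 0)); pose f := eps (phi (chi 0 1)).
have hc : compatible 0 e 0 f by rewrite /compatible nb1' eqxx.
have det0 : (1 : K) * 1 - 0 * 0 != 0 by rewrite mulr1 mulr0 subr0 oner_eq0.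
pose T := affsubst 1 1 hc; have cT : conn idfun T := affsubst_conn hc det0.
have [T' [TK T'K]] := inverse_lrmorphism (affsubst_bij hc det0).
have eT g : eps (phi g) = eps (T g).
  elim/span_ind: g => [|c g g' h h'|p q _]; first by rewrite !rmorph0.
    by rewrite !linearP /eps !cfD !cfZ -!/(eps _) h h'.
  rewrite (eps_chi_morph phi) // (eps_chi_morph T) // -/e -/f.
  rewrite /eps /cf !iota_subst_chi ?Sall // !expr0 !expr1 mul1r mulr1 /aff.
  rewrite !mcoeffD !mcoeffZ !mcoeffC mX0 mX1 !mcoeffX !eq_mk -mk00 !eq_mk /=.
  by rewrite !mulr0 !mulr1 !add0r.
have b' : bijective (phi \o T') by exists (T \o phi') => g /=; rewrite ?phiK ?TK ?T'K ?phi'K.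
have [s [sK s'K]] := @inverse_lrmorphism (phi \o T') b'.
have c1 : conn idfun (phi \o T').
  apply: (conn_linear_case h1 sK s'K) => g /=.
  by rewrite eT T'K.
have bT : bijective T by exists T'.
have := conn_compr bT c1; move/(conn_trans cT).
by apply: conn_eq => // g /=; rewrite TK.
Qed.

Lemma swap_exists : (forall p q, S p q -> S q p) ->
  exists tau : {lrmorphism A -> A},
    involutive tau /\ forall p q, S p q -> tau (chi p q) = chi q p.
Proof.
move=> sym; pose t (f : A) : A := lin_extend (fun p q => chi q p) (iota f).
have tX p q : S p q -> t (chi p q) = chi q p.
  by move=> h; rewrite /t iota_chi // lin_extendX.
have lt : linear t by move=> c f g; rewrite /t linearP lin_extend_linear.
have t1 : t 1 = 1 by rewrite -chi00 tX ?in_cone_00.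
have t0 : t 0 = 0 by rewrite /t rmorph0 /lin_extend msupp0 big_nil.
clearbody t.
have tM : {morph t : f g / f * g}.
  move=> f g; elim/span_ind: f => [|c f f' h h'|p q Sp].
  - by rewrite mul0r !t0 mul0r.
  - by rewrite mulrDl -scalerAl !lt h h' mulrDl -scalerAl.
  elim/span_ind: g => [|c f f' h h'|s u Su].
  - by rewrite mulr0 !t0 mulr0.
  - by rewrite mulrDr -scalerAr !lt h h' mulrDr -scalerAr.
  rewrite (chiM Sp Su) (tX _ _ (in_coneD Su Sp)) (tX _ _ Sp) (tX _ _ Su).
  by rewrite (chiM (sym _ _ Sp) (sym _ _ Su)).
have [tau et] := lrmorphism_of lt t1 tM.
have tauX p q : S p q -> tau (chi p q) = chi q p by move=> h; rewrite et tX.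
exists tau; split=> //; apply: (@lrmorphism_ext (tau \o tau) idfun) => p q Sp /=.
by rewrite (tauX _ _ Sp) (tauX _ _ (sym _ _ Sp)).
Qed.

(** * The two types of automorphisms *)

(* The graded automorphism associated with phi is diagonal, up to the exchange
   of x and y if b holds. *)
Definition leading (b : bool) (phi : A -> A) : Prop :=
  forall p q, S p q -> exists2 c, c != 0 & forall p' q', (p' + q' = p + q)%N ->
    cf (phi (chi p q)) p' q' = c * ((p', q') == flip b p q)%:R.

Lemma filtered_vanish (phi : {lrmorphism A -> A}) d f :
  filtered phi -> vanish_below d f -> vanish_below d (phi f).
Proof.
move=> F; move: f; apply: vanish_below_ind => [|c f f' h h'|p q Sp dp].
- by move=> p q _; rewrite rmorph0 cf0.
- by move=> p q hpq; rewrite linearP cfD cfZ h ?h' // mulr0 addr0.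
by move=> p' q' h; apply: F => //; apply: leq_trans dp.
Qed.

Lemma flip_sum b p q : ((flip b p q).1 + (flip b p q).2 = p + q)%N.
Proof. by case: b => //=; rewrite addnC. Qed.

Lemma leading_comp (phi phi' : {lrmorphism A -> A}) b b' :
  filtered phi -> filtered phi' -> leading b phi -> leading b' phi' ->
  leading (b (+) b') (phi \o phi').
Proof.
move=> F F' h h' p q Sp; have [c' c'0 e'] := h' _ _ Sp.
pose s := (flip b' p q).1; pose t := (flip b' p q).2.
have st : (s + t = p + q)%N := flip_sum b' p q.
have fst : flip b' p q = (s, t) by rewrite /s /t; case: flip.
have Sst : S s t.
  apply: contraT => /(cf_out (phi' (chi p q))) h0.
  by have := e' _ _ st; rewrite h0 fst eqxx mulr1 => h1; rewrite -h1 eqxx in c'0.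
have [c c0 e] := h _ _ Sst.
exists (c' * c); first by rewrite mulf_neq0.
(* The remainder [r] has only terms of degree above [p + q]; since [phi] is filtered, it does not
   affect the coefficients in degree [p + q]. *)
move=> p' q' hpq; pose r := phi' (chi p q) - c' *: chi s t.
have vr : vanish_below (p + q).+1 r.
  move=> x y hxy; rewrite /r cfB cfZ cf_chi //.
  case: (ltngtP (x + y) (p + q)) => hxy'; first last.
  - by rewrite e' // fst xpair_eqE [x == s]eq_sym [y == t]eq_sym subrr.
  - by rewrite ltnNge -ltnS hxy in hxy'.
  rewrite F' // sub0r; have [xs|_] := eqVneq s x; last by rewrite mulr0 oppr0.
  have [yt|_] := eqVneq t y; last by rewrite mulr0 oppr0.
  by rewrite -st xs yt ltnn in hxy'.
have -> : (phi \o phi') (chi p q) = c' *: phi (chi s t) + phi r.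
  by rewrite /= -linearZ -rmorphD /r addrC subrK.
rewrite cfD (filtered_vanish F vr) ?hpq // addr0 cfZ e ?hpq ?st // mulrA.
congr (_ * (_ == _)%:R); rewrite /s /t.
by case: b {h e}; case: b' {h' e' s t st fst Sst c c0 r vr}.
Qed.

(** Two coefficients that detect the type; in a family they vary as regular functions of the
    parameter. *)
Lemma leading_coef b (phi : A -> A) : leading b phi ->
  (cf (phi (chi nb 0)) 0 nb == 0) = ~~ b /\ (cf (phi (chi nb 0)) nb 0 == 0) = b.
Proof.
move=> h; have [c c0 e] := h _ _ (in_cone_b0 na nb).
rewrite !e // ?addn0 ?add0n //; have nb0 : (nb == 0)%N = false by rewrite gtn_eqF.
case: b {h} e => _; rewrite /= !xpair_eqE !eqxx ?[(0 == nb)%N]eq_sym nb0 /=;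
  by rewrite ?mulr0 ?mulr1 ?eqxx (negbTE c0).
Qed.

Lemma leading_inj b b' (phi : A -> A) : leading b phi -> leading b' phi -> b = b'.
Proof. by move=> /leading_coef[_ <-] /leading_coef[_ <-]. Qed.

Lemma leading_id : leading false (@idfun A).
Proof.
move=> p q Sp; exists 1; first exact: oner_neq0.
move=> p' q' _; rewrite mul1r /= cf_chi // xpair_eqE.
by rewrite [p == _]eq_sym [q == _]eq_sym.
Qed.

Hypothesis na_bounds : (1 < na < nb)%N.

Lemma nb_gt1 : (1 < nb)%N. Proof. by case/andP: na_bounds => h h'; lia. Qed.

Lemma aut_is_filtered (phi : {lrmorphism A -> A}) : bijective phi -> filtered phi.
Proof.
move=> /inverse_lrmorphism[phi' [phiK phi'K]] p q p' q' Sp.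
exact: (aut_filtered phiK phi'K (aut_eps nb_gt1 phiK phi'K)).
Qed.

(** Degeneration to a graded map followed by [graded_monomial]. In the exchanging case [g \o tau] is
    diagonal, which connects [phi] to [tau]. *)
Lemma aut_leading (phi : {lrmorphism A -> A}) : bijective phi ->
  exists b, [/\ leading b phi, b = false -> conn idfun phi &
    b -> (forall p q, S p q -> S q p) /\
      forall tau : {lrmorphism A -> A}, involutive tau ->
        (forall p q, S p q -> tau (chi p q) = chi q p) -> conn tau phi].
Proof.
move=> bphi; have F := aut_is_filtered bphi.
have [phi' [phiK phi'K]] := inverse_lrmorphism bphi.
have F' : filtered phi' by apply: aut_is_filtered; exists phi.
have [g [g' [gK g'K cg h h']]] := degeneration F F' phiK phi'K.
have [b H] := graded_monomial gK g'K (degeneration_graded h)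
  (degeneration_graded h') na_bounds.
exists b; split.
- move=> p q Sp; have [Sf [c c0 e]] := H _ _ Sp; exists c => // p' q' hpq.
  have := h _ _ p' q' Sp; rewrite hpq eqxx => <-; rewrite e cfZ cf_chi //.
  by rewrite [flip b p q]surjective_pairing xpair_eqE [p' == _]eq_sym [q' == _]eq_sym.
- move=> b0; apply: conn_trans cg; apply: conn_torus.
    by case/andP: na_bounds.
  by move=> p q Sp; have [_] := H _ _ Sp; rewrite b0.
move=> b1; rewrite b1 /= in H.
have sym p q : S p q -> S q p by move=> /H[].
split=> // tau tauK tauX; apply: conn_trans cg.
have bt : bijective tau by exists tau.
have c1 : conn idfun (g \o tau).
  apply: conn_torus; first by case/andP: na_bounds.
  move=> p q Sp /=; rewrite tauX //.
  by have [_ ?] := H _ _ (sym _ _ Sp).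
have := conn_compr bt c1; apply: conn_eq => // f /=.
by rewrite tauK.
Qed.

(** The exchange of [(1, nb - na)] lies in the cone exactly when [na^2 = 1] modulo [nb]; conversely,
    multiply the congruence defining the cone by [na]. *)
Lemma in_cone_sym : (forall p q, S p q -> S q p) <-> (nb %| na ^ 2 - 1)%N.
Proof.
have na0 : (0 < na)%N by case/andP: na_bounds => h _; lia.
have h1 : (na ^ 2 = (na ^ 2 - 1) + 1)%N by rewrite subnK // expn_gt0 na0.
split=> [h|h p q].
  have := h _ _ (in_cone_1 na_le); rewrite /in_cone => h2.
  rewrite -(dvdn_addr _ h2).
  have -> : (1 + na * (nb - na) + (na ^ 2 - 1) = na * nb)%N.
    have : (na * na <= na * nb)%N by rewrite leq_mul2l na_le orbT.
    by move: h1; rewrite mulnBr -mulnn; lia.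
  by rewrite dvdn_mull.
rewrite /in_cone => h2; have : (nb %| na * (q + na * p))%N by rewrite dvdn_mull.
rewrite mulnDr mulnA mulnn h1 mulnDl mul1n addnCA dvdn_addr ?dvdn_mulr //.
by rewrite addnC.
Qed.

End InvariantRing.

(** * The coordinate ring and its automorphisms *)

Section MonoidAlgebra.
Import monalg.

Lemma malg_scaleU (T : choiceType) (R : nzRingType) (c : R) (m : T) :
  mkmalgU m c = c *: mkmalgU m 1.
Proof.
apply/malgP => k; rewrite monalg.mcoeffZ !mcoeffU.
by rewrite mulrnAr mulr1.
Qed.

End MonoidAlgebra.

Section CoordinateRing.
Variables (K : closedFieldType) (a b : int) (b_gt0 : 0 < b).
Hypotheses (a_ge0 : 0 <= a).
Local Notation B := {mpoly K[2]}.
Local Notation M := (toric_semigroup a b_gt0).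
Local Notation na := `|a|%N.
Local Notation nb := `|b|%N.
Local Notation S := (in_cone na nb).

Definition exp1 (m : M) : nat := `|(lattice_point m).2|%N.
Definition exp2 (m : M) : nat :=
  absz (b * (lattice_point m).1 - a * (lattice_point m).2)%R.

Lemma toric_bounds (m : M) :
  0 <= (lattice_point m).2 /\ 0 <= b * (lattice_point m).1 - a * (lattice_point m).2.
Proof.
case: m => [[m1 m2] /=]; rewrite /dual_cone /pairing /= => /and3P[h1 h2 _].
by split; lia.
Qed.

Lemma exp1E m : (exp1 m)%:Z = (lattice_point m).2.
Proof. by have [h _] := toric_bounds m; rewrite /exp1 gez0_abs. Qed.

Lemma exp2E m : (exp2 m)%:Z = b * (lattice_point m).1 - a * (lattice_point m).2.
Proof. by have [_ h] := toric_bounds m; rewrite /exp2 gez0_abs. Qed.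

Lemma naE : na%:Z = a. Proof. by rewrite gez0_abs. Qed.
Lemma nbE : nb%:Z = b. Proof. by rewrite gtz0_abs. Qed.

Lemma exp_inS m : S (exp1 m) (exp2 m).
Proof.
rewrite /in_cone.
have e : (exp2 m + na * exp1 m)%N%:Z = b * (lattice_point m).1.
  by rewrite PoszD PoszM exp1E exp2E naE; ring.
by rewrite -(absz_nat (_ + _)) e abszM dvdn_mulr.
Qed.

(** Recovers the lattice point from its exponents; meaningful on [S], where the division is
    exact. *)
Definition toric_point (p q : nat) : M :=
  insubd (toric_one a b_gt0) (((q + na * p) %/ nb)%N%:Z, p%:Z).

Lemma toric_pointE p q : S p q ->
  lattice_point (toric_point p q) = (((q + na * p) %/ nb)%N%:Z, p%:Z).
Proof.
move=> h; suff hd : dual_cone (cone_generators a b) (((q + na * p) %/ nb)%N%:Z, p%:Z).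
  by rewrite [LHS]insubdK.
have e : b * ((q + na * p) %/ nb)%N%:Z = q%:Z + a * p%:Z.
  by rewrite -{1}nbE -PoszM mulnC divnK // PoszD PoszM naE.
apply/allP => v; rewrite !inE => /orP[]/eqP->; rewrite /pairing /=.
  by rewrite mulr0 add0r mulr1.
by rewrite [_ * b]mulrC e mulrN [p%:Z * a]mulrC addrK.
Qed.

Lemma toric_pointK p q : S p q ->
  exp1 (toric_point p q) = p /\ exp2 (toric_point p q) = q.
Proof.
move=> h; rewrite /exp1 /exp2 toric_pointE //=; split=> //.
have e : b * ((q + na * p) %/ nb)%N%:Z = q%:Z + a * p%:Z.
  by rewrite -{1}nbE -PoszM mulnC divnK // PoszD PoszM naE.
by rewrite e addrK.
Qed.

Lemma expK m : toric_point (exp1 m) (exp2 m) = m.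
Proof.
apply: val_inj; rewrite /= toric_pointE ?exp_inS //.
rewrite [RHS]surjective_pairing exp1E; congr (_, _).
have e : (exp2 m + na * exp1 m)%N%:Z = b * (lattice_point m).1.
  by rewrite PoszD PoszM exp1E exp2E naE; ring.
have b0 : b != 0 by rewrite gt_eqF.
apply: (mulfI b0); rewrite -e -{1}nbE -PoszM mulnC divnK //.
exact: exp_inS.
Qed.

Definition monomial_of (m : M) : B := 'X_[mk (exp1 m) (exp2 m)].

Definition toric_monom : monalg.MonomialDef.type := monalg.MonomialDef.clone M _.

Lemma monomial_of_mmorphism : @monalg.mmorphism toric_monom B monomial_of.
Proof.
split=> [x y|].
  rewrite /monomial_of -mpolyXD mkD; congr 'X_[mk _ _].
    apply/eqP; rewrite -eqz_nat PoszD !exp1E; apply/eqP.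
    by case: x y => [[? ?] ?] [[? ?] ?].
  apply/eqP; rewrite -eqz_nat PoszD !exp2E; apply/eqP.
  by case: x y => [[? ?] ?] [[? ?] ?] /=; ring.
by rewrite /monomial_of /exp1 /exp2 /= !mulr0 subr0 mk00 mpolyX0.
Qed.
Definition monomial_morphism : monalg.MMorphism.type toric_monom B :=
  monalg.MMorphism.Pack (monalg.MMorphism.Class
    (monalg.isMultiplicative.Axioms_ _ _ monomial_of_mmorphism)).

Local Notation A := (semigroup_algebra a b_gt0 K).

Definition embed_fun : A -> B := monalg.mmap (@mpolyC 2 K) monomial_of.

Lemma embed_linear : linear embed_fun.
Proof.
move=> c f g; rewrite /embed_fun [LHS]monalg.mmapD -mul_mpolyC; congr (_ + _).
exact: (@monalg.mmapZ toric_monom K B (@mpolyC 2 K) monomial_morphism).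
Qed.

Lemma embed_one : embed_fun 1 = 1.
Proof. exact: (@monalg.mmap1 toric_monom K B (@mpolyC 2 K) monomial_morphism). Qed.

Lemma embed_mul : {morph embed_fun : f g / f * g}.
Proof.
have [h _] := @monalg.mmap_is_multiplicative toric_monom K B (@mpolyC 2 K) monomial_morphism.
by move=> f g; apply: h.
Qed.

Definition embed : {lrmorphism A -> B} :=
  sval (lrmorphism_of embed_linear embed_one embed_mul).

Lemma embedE : embed =1 embed_fun.
Proof. by rewrite /embed; case: lrmorphism_of. Qed.

Definition character m : A := monalg.mkmalgU m (1 : K).

Definition reynolds_fun : B -> A :=
  lin_extend (fun p q => if S p q then character (toric_point p q) else 0).

Lemma reynolds_linear : linear reynolds_fun.
Proof. exact: lin_extend_linear. Qed.
HB.instance Definition _ := GRing.isLinear.Build K B A *:%R reynolds_fun reynolds_linear.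
Definition reynolds : {linear B -> A} := reynolds_fun.

Lemma reynoldsX p q : reynolds 'X_[mk p q] =
  if S p q then character (toric_point p q) else 0.
Proof. exact: lin_extendX. Qed.

Lemma embed_character m : embed (character m) = monomial_of m.
Proof. by rewrite embedE [LHS]monalg.mmapU mul1r. Qed.

Lemma character_span (f : A) :
  exists (r : seq M) (c : M -> K), f = \sum_(m <- r) c m *: character m.
Proof.
exists (finmap.enum_fset (monalg.msupp f)), (fun m => monalg.mcoeff m f).
rewrite {1}[f]monalg.monalgE; apply: eq_bigr => m _.
exact: malg_scaleU.
Qed.

Lemma embedK : cancel embed reynolds.
Proof.
move=> f; have [r [c ->]] := character_span f; rewrite !linear_sum.
apply: eq_bigr => m _; rewrite !linearZ /= embed_character /monomial_of.
by rewrite reynoldsX exp_inS expK.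
Qed.

Lemma embed_reynoldsX p q :
  embed (reynolds 'X_[mk p q]) = if S p q then 'X_[mk p q] else 0.
Proof.
rewrite reynoldsX; case: ifP => h; last by rewrite rmorph0.
rewrite embed_character /monomial_of.
by have [-> ->] := toric_pointK h.
Qed.

End CoordinateRing.

Section EvaluationZero.
Variable K : fieldType.
Hypothesis char0 : forall n, n.+1%:R != 0 :> K.

(* Kronecker substitution x = t, y = t^N separates the monomials of p. *)
Lemma mpoly2_eq0 (p : {mpoly K[2]}) : (forall w, p.@[w] = 0) -> p = 0.
Proof.
move=> p0; pose N := msize p.
pose Q : {poly K} := \sum_(m <- msupp p) p@_m *: 'X^(m ord0 + N * m ord_max).
have Q0 : Q = 0.
  apply: (poly_eq0_nat char0 (J := 0)) => j _.
  rewrite -(p0 (fun i => if i == ord0 then j%:R else j%:R ^+ N)).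
  rewrite /Q horner_sum mevalE; apply: eq_bigr => m _.
  rewrite hornerZ hornerXn exprD exprM big_ord_recl big_ord1 eqxx.
  by congr (_ * (_ * _ ^+ m _)); apply: val_inj.
apply/mpolyP => m; rewrite mcoeff0.
case: (boolP (m \in msupp p)) => [hm|/memN_msupp_eq0//].
have small m' : m' \in msupp p -> (m' ord0 < N)%N.
  move/msize_mdeg_lt; apply: leq_ltn_trans.
  by rewrite (mkE m') mdeg_mk mk0 leq_addr.
have := congr1 (fun q : {poly K} => q`_(m ord0 + N * m ord_max)) Q0.
rewrite coef0 coef_sum (bigD1_seq m) ?msupp_uniq //= coefZ coefXn eqxx mulr1.
rewrite big_seq_cond big1 ?addr0 // => m' /andP[hm' nm'].
rewrite coefZ coefXn; case: eqP => [e|_]; last by rewrite mulr0.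
case/eqP: nm'; have h1 := small _ hm; have h2 := small _ hm'.
have e0 : m' ord0 = m ord0.
  have := congr1 (fun k => k %% N)%N e.
  by rewrite /= ![(N * _)%N]mulnC ![(_ + _ * N)%N]addnC !modnMDl !modn_small.
apply: mnm2P => //; move/eqP: e; rewrite e0 eqn_add2l eqn_pmul2l => [/eqP->//|].
exact: leq_ltn_trans h1.
Qed.

End EvaluationZero.

(** * Automorphisms and algebraic families on [Spec A] *)

Section Spectrum.
Variables (K : closedFieldType) (A : comAlgType K).
Local Notation X := (Spec A).
Hypothesis separated : forall c c' : A, (forall x : X, x c = x c') -> c = c'.

Lemma point_ext (x y : X) : x =1 y -> x = y.
Proof.
case: x y => [f cf] [g cg] /= /funext e; subst g; congr GRing.LRMorphism.Pack.
case: cf cg => [[p1] [p2] [p3]] [[q1] [q2] [q3]].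
by rewrite (Prop_irrelevance p1 q1) (Prop_irrelevance p2 q2) (Prop_irrelevance p3 q3).
Qed.

(** The comorphism of [g], obtained by choice; its algebraic properties follow because points
    separate elements of [A]. *)
Lemma pull_exists (g : automorphism X) : exists phi : {lrmorphism A -> A},
  forall (x : X) c, g x c = x (phi c).
Proof.
have [f hf] : {f : A -> A & forall c x, g x c = x (f c)}.
  apply: (@choice _ _ (fun c d => forall x : X, (g x : X) c = x d)) => c.
  by apply: (aut_fun_morph g (h := fun x : X => x c)); exists c.
have lf : linear f.
  by move=> c u v; apply: separated => x; rewrite -hf !linearP /= !hf.
have f1 : f 1 = 1 by apply: separated => x; rewrite -hf !rmorph1.
have fM : {morph f : u v / u * v}.
  by move=> u v; apply: separated => x; rewrite -hf !rmorphM /= !hf.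
have [phi ephi] := lrmorphism_of lf f1 fM.
by exists phi => x c; rewrite ephi.
Qed.

Definition pull (g : automorphism X) : {lrmorphism A -> A} :=
  sval (cid (pull_exists g)).

Lemma pullE (g : automorphism X) (x : X) c : g x c = x (pull g c).
Proof. exact: (svalP (cid (pull_exists g))). Qed.

Lemma pull1 : pull (1%g : Aut X) =1 id.
Proof. by move=> c; apply: separated => x; rewrite -pullE. Qed.

Lemma pullM (g h : Aut X) : pull (g * h)%g =1 pull h \o pull g.
Proof. by move=> c; apply: separated => x; rewrite -pullE /= -!pullE. Qed.

Lemma pull_bij (g : Aut X) : bijective (pull g).
Proof.
exists (pull g^-1%g) => c.
  by rewrite -[RHS]pull1 -(mulgV g) pullM.
by rewrite -[RHS]pull1 -(mulVg g) pullM.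
Qed.

Lemma push_exists (phi psi : {lrmorphism A -> A}) :
  cancel phi psi -> cancel psi phi ->
  exists g : Aut X, forall (x : X) c, g x c = x (phi c).
Proof.
move=> phiK psiK.
pose F (x : X) : X := (x \o phi : {lrmorphism A -> K | *%R}).
pose G (x : X) : X := (x \o psi : {lrmorphism A -> K | *%R}).
have FK : cancel F G by move=> x; apply: point_ext => c /=; rewrite psiK.
have GK : cancel G F by move=> x; apply: point_ext => c /=; rewrite phiK.
have mF : regular_morphism F by move=> h [c hc]; exists (phi c) => x; rewrite hc.
have mG : regular_morphism G by move=> h [c hc]; exists (psi c) => x; rewrite hc.
by exists (Automorphism FK GK mF mG).
Qed.

Lemma pull_inj (g h : Aut X) : pull g =1 pull h -> g = h.
Proof. by move=> e; apply: autP => x; apply: point_ext => c; rewrite !pullE e. Qed.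

Section PrincipalOpen.
Variable h : {poly K}.

Definition coord (t : K) (i : 'I_2) : K := if i == ord0 then t else (h.[t])^-1.

(** The open set [h != 0] of the affine line, embedded in the plane as the curve [h(x) y = 1]. *)
Definition principal_open : fun_space K :=
  @FunSpace K {t : K | h.[t] != 0}
    (fun f => exists p : {mpoly K[2]}, forall v, f v = p.@[coord (sval v)]).

Let hX : {mpoly K[2]} := (map_poly (@mpolyC 2 K) h).['X_ord0].

Lemma meval_hX w : hX.@[w] = h.[w ord0].
Proof.
rewrite /hX horner_coef size_map_inj_poly ?mpolyC0 //; last first.
  by move=> x y /(can_inj (@mpolyCK 2 K)).
rewrite horner_coef !raddf_sum /=; apply: eq_bigr => i _.
by rewrite mevalM coef_map_id0 ?mpolyC0 // mevalC rmorphXn /= mevalXU.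
Qed.

Lemma principal_open_affine : affine principal_open.
Proof.
exists 2%N, (fun i v => coord (sval v) i); split=> //.
  move=> [t ht] [u hu] /(_ ord0); rewrite /coord eqxx /= => e; subst u.
  by congr exist; apply: bool_irrelevance.
exists [set hX * 'X_ord_max - 1]%classic => y; split.
  case=> -[t ht] /= ey p -> ; rewrite mevalB mevalM meval_hX mevalXU meval1.
  by rewrite -!ey /coord /= divff // subrr.
move=> /(_ _ erefl); rewrite mevalB mevalM meval_hX mevalXU meval1.
move/eqP; rewrite subr_eq0 => /eqP e.
have h0 : h.[y ord0] != 0.
  by apply: contra_eq_neq e => ->; rewrite mul0r eq_sym oner_neq0.
exists (exist _ (y ord0) h0) => -[[|[|//]] hi] /=; rewrite /coord /=.
  by congr y; apply: val_inj.
rewrite (_ : Ordinal hi = ord_max); last by apply: val_inj.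
by apply: (mulfI h0); rewrite divff.
Qed.

Hypothesis char0 : forall n, n.+1%:R != 0 :> K.

(** A high power of [h] clears the denominators, turning regular functions into polynomials in one
    variable. *)
Lemma regular_numerator (f : principal_open -> K) : regular f ->
  exists (q : {poly K}) (k : nat), forall v, f v * h.[sval v] ^+ k = q.[sval v].
Proof.
case=> p hp; exists (\sum_(m <- msupp p) p@_m *: ('X^(m ord0) * h ^+ (msize p - m ord_max))).
exists (msize p) => v; rewrite hp mevalE mulr_suml horner_sum big_seq [RHS]big_seq.
apply: eq_bigr => m hm; rewrite hornerZ hornerM hornerXn horner_exp -mulrA.
congr (_ * _).
have hs : (m ord_max <= msize p)%N.
  apply: ltnW; apply: leq_ltn_trans (msize_mdeg_lt hm).
  by rewrite (mkE m) mdeg_mk mk1 leq_addl.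
rewrite big_ord_recl big_ord1 /coord eqxx -mulrA; congr (_ * _).
have -> : lift ord0 ord0 = ord_max :> 'I_2 by apply: val_inj.
rewrite /= -{1}(subnK hs) exprD mulrCA -exprMn mulVf ?expr1n ?mulr1 //.
exact: (svalP v).
Qed.

Lemma principal_open_irreducible : h != 0 -> irreducible principal_open.
Proof.
move=> h0.
have nz (q : {poly K}) : q != 0 -> exists t, q.[t] != 0.
  move=> q0; apply: contrapT => H; case/eqP: q0.
  apply: (poly_eq0_nat char0 (J := 0)) => j _; apply/eqP; apply: contraT => hq.
  by case: H; exists j%:R.
split; first by have [t ht] := nz h h0; exists (exist _ t ht).
move=> Z1 Z2 [E1 r1 e1] [E2 r2 e2] cover; apply: contrapT => /not_orP[n1 n2].
have [v1 w1] : exists v, ~ Z1 v by apply/existsNP.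
have [v2 w2] : exists v, ~ Z2 v by apply/existsNP.
have [f1 [E1f1 f1v]] : exists f, E1 f /\ f v1 != 0.
  apply: contrapT => H; apply: w1; apply/e1 => f Ef; apply/eqP; apply: contraT => hf.
  by case: H; exists f.
have [f2 [E2f2 f2v]] : exists f, E2 f /\ f v2 != 0.
  apply: contrapT => H; apply: w2; apply/e2 => f Ef; apply/eqP; apply: contraT => hf.
  by case: H; exists f.
have [q1 [k1 hq1]] := regular_numerator (r1 _ E1f1).
have [q2 [k2 hq2]] := regular_numerator (r2 _ E2f2).
have q10 : q1 != 0.
  apply: contraNneq f1v => e; have := hq1 v1; rewrite e horner0 => /eqP.
  by rewrite mulf_eq0 expf_eq0 (negbTE (svalP v1)) andbF orbF.
have q20 : q2 != 0.
  apply: contraNneq f2v => e; have := hq2 v2; rewrite e horner0 => /eqP.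
  by rewrite mulf_eq0 expf_eq0 (negbTE (svalP v2)) andbF orbF.
(* At a point where this nonzero product does not vanish, neither closed set can contain the
   point. *)
have [t] := nz (h * q1 * q2) (mulf_neq0 (mulf_neq0 h0 q10) q20).
rewrite !hornerM !mulf_eq0 !negb_or => /andP[/andP[ht ht1] ht2].
have [/e1/(_ _ E1f1)|/e2/(_ _ E2f2)] := cover (exist _ t ht) => e.
  by have := hq1 (exist _ t ht); rewrite e mul0r /= => e'; rewrite -e' eqxx in ht1.
by have := hq2 (exist _ t ht); rewrite e mul0r /= => e'; rewrite -e' eqxx in ht2.
Qed.

End PrincipalOpen.

Hypothesis char0 : forall n, n.+1%:R != 0 :> K.

Lemma conn_in_family (g : Aut X) (phi : {lrmorphism A -> A}) :
  conn idfun phi -> pull g =1 phi -> in_family_with_identity g.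
Proof.
move=> [h [Phi [[h0 h1] hb P0 P1 pP]]] eg.
have hn0 : h != 0 by apply: contraNneq h0 => ->; rewrite horner0.
pose V := principal_open h.
have [F hF] : {F : V -> Aut X & forall v (x : X) c, F v x c = x (Phi (sval v) c)}.
  apply: (@choice _ _ (fun v g => forall (x : X) c, (g : Aut X) x c = x (Phi (sval v) c))).
  move=> v; have [psi [K1 K2]] := inverse_lrmorphism (hb _ (svalP v)).
  exact: push_exists K1 K2.
exists V, F; split.
- split; [exact: principal_open_affine | exact: principal_open_irreducible | ].
  move=> r [c hc]; have [G hG] := pP c.
  exists (size G), (fun (i : 'I__) (v : V) => sval v ^+ i),
    (fun (i : 'I__) (x : X) => x G`_i); split.
  + by move=> i; exists ('X_ord0 ^+ i) => v; rewrite rmorphXn /= mevalXU /coord eqxx.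
  + by move=> i; exists G`_i.
  move=> [v x] /=; rewrite hc hF hG horner_coef raddf_sum; apply: eq_bigr => i _ /=.
  rewrite rmorphM /= exprZn expr1n linearZ /= rmorph1 mulr1.
  by rewrite mulrC.
- exists (exist _ 1 h1); apply: pull_inj => c; rewrite eg -P1.
  by apply: separated => x; rewrite -pullE hF.
- exists (exist _ 0 h0); apply: pull_inj => c; rewrite pull1.
  by apply: separated => x; rewrite -pullE hF /= P0.
Qed.

(** Regularity on the product writes [pull (F v) c] as a finite sum of fixed elements [d i] with
    coefficients regular in [v]; a linear functional then gives a regular function. *)
Lemma family_coefficient (V : fun_space K) (F : V -> Aut X) (l : {scalar A}) c :
  algebraic_family F -> regular (fun v => l (pull (F v) c)).
Proof.
case=> affV _ mF; have := mF (fun x => x c); case; first by exists c.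
move=> n [f [r [rf rr hfr]]].
have [d hd] : {d : 'I_n -> A & forall i (x : X), r i x = x (d i)}.
  by apply: (@choice _ _ (fun i d => forall x : X, r i x = x d)) => i; apply: rr.
case: affV => m [x [hreg _ _]].
have /choice[p hp] i : exists p : {mpoly K[m]}, forall v, f i v = p.@[fun j => x j v].
  exact/hreg.
apply/hreg; exists (\sum_i l (d i) *: p i) => v.
have -> : pull (F v) c = \sum_i f i v *: d i.
  apply: separated => y; rewrite -pullE; have := hfr (v, y); rewrite /= => ->.
  by rewrite raddf_sum; apply: eq_bigr => i _ /=; rewrite hd linearZ.
rewrite !raddf_sum; apply: eq_bigr => i _ /=.
by rewrite linearZ /= mevalZ hp mulrC.
Qed.

End Spectrum.

(** * The components of the automorphism group *)

Section AutomorphismComponents.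
Variables (K : closedFieldType) (na nb : nat).
Hypothesis char0 : forall n, n.+1%:R != 0 :> K.
Hypothesis nb_gt0 : (0 < nb)%N.
Hypothesis na_le : (na <= nb)%N.
Hypothesis cop : coprime na nb.

Local Notation B := {mpoly K[2]}.
Local Notation S := (in_cone na nb).

Variables (A : comAlgType K) (iota : {lrmorphism A -> B}).
Variable rho : {linear B -> A}.
Hypothesis iotaK : cancel iota rho.
Hypothesis iota_rhoX : forall p q,
  iota (rho 'X_[mk p q]) = if S p q then 'X_[mk p q] else 0.

Local Notation X := (Spec A).

(** Evaluations at points of the plane, composed with [iota], already separate. *)
Lemma points_separate (c c' : A) : (forall x : X, x c = x c') -> c = c'.
Proof.
move=> h; apply: (can_inj iotaK); apply/eqP; rewrite -subr_eq0; apply/eqP.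
apply: (mpoly2_eq0 char0) => w.
pose x : X := (meval w \o iota : {lrmorphism A -> K | *%R}).
by have := h x; rewrite /= mevalB => ->; rewrite subrr.
Qed.

Local Notation pull := (pull points_separate).
Local Notation leads := (leading na nb iota rho).

Lemma small_connected : (na == 1%N) || (nb == 1%N) -> Aut_connected X.
Proof.
move=> h1 g; have [phi' [K1 K2]] := inverse_lrmorphism (pull_bij points_separate g).
apply: (conn_in_family (separated := points_separate) char0 (phi := pull g)) => //.
exact: (conn_id_all char0 nb_gt0 na_le cop iotaK iota_rhoX h1 K1 K2).
Qed.

Hypothesis na_bounds : (1 < na < nb)%N.

Lemma pull_leading (g : Aut X) : exists b, leads b (pull g) /\
  (b = false -> in_family_with_identity g) /\ (b -> forall p q, S p q -> S q p).
Proof.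
have [b [h1 h2 h3]] := aut_leading char0 nb_gt0 na_le cop iotaK iota_rhoX na_bounds
  (pull_bij points_separate g).
exists b; split=> //; split=> [/h2 h|/h3[]//].
exact: (conn_in_family (separated := points_separate) char0 h).
Qed.

Lemma pull_filtered (g : Aut X) : filtered na nb iota rho (pull g).
Proof.
exact: (aut_is_filtered char0 nb_gt0 na_le cop iotaK iota_rhoX na_bounds
  (pull_bij points_separate g)).
Qed.

Lemma leading_eq b (f g : A -> A) : f =1 g -> leads b f -> leads b g.
Proof.
move=> e h p q Sp; have [c c0 h'] := h _ _ Sp; exists c => // p' q' hpq.
by rewrite -e h'.
Qed.

Lemma leading_mul b c (g h : Aut X) :
  leads b (pull g) -> leads c (pull h) -> leads (b (+) c) (pull (g * h)%g).
Proof.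
move=> hg hh; rewrite addbC.
apply: leading_eq (leading_comp iotaK iota_rhoX (pull_filtered h) (pull_filtered g) hh hg).
by move=> f; rewrite pullM.
Qed.

Lemma leading_one : leads false (pull 1%g).
Proof. by apply: leading_eq (leading_id iota_rhoX) => f; rewrite pull1. Qed.

(** Types add under products and the identity has type [false], so inverse automorphisms have equal
    types. *)
Lemma leading_invg b (g : Aut X) : leads b (pull g) -> leads b (pull g^-1%g).
Proof.
move=> hg; have [c [hc _]] := pull_leading g^-1%g.
have := leading_mul hg hc; rewrite mulgV => h.
have := leading_inj nb_gt0 h leading_one.
by case: b c hg hc {h} => -[].
Qed.

Lemma family_leading (g : Aut X) : in_family_with_identity g -> leads false (pull g).
Proof.
move=> [V [F [famF [s es] [s1 es1]]]].
pose l p q : {scalar A} := (mcoeff (mk p q) \o iota : {linear A -> K | *%R}).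
pose z p q v := l p q (pull (F v) (chi rho nb 0)).
have rz p q : regular (z p q) by apply: family_coefficient.
have [_ [_ irr] _] := famF.
pose Z p q := fun v => z p q v = 0.
have cZ p q : zariski_closed (Z p q).
  exists (fun f => f = z p q) => [f ->|v]; first exact: rz.
  by split=> [h f ->|h]; [|apply: h].
have lc b v : leads b (pull (F v)) -> (z 0 nb v == 0) = ~~ b /\ (z nb 0 v == 0) = b.
  exact: (leading_coef nb_gt0).
(* The two zero sets cover the irreducible base, so one is everything. It cannot be that of
   [z nb 0], which is nonzero at the identity; hence [z 0 nb] vanishes at [g] too, which gives type
   [false]. *)
case: (irr _ _ (cZ 0 nb)%N (cZ nb 0)%N).
- move=> v; have [[] [/lc[h h'] _]] := pull_leading (F v).
    by right; apply/eqP.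
  by left; apply/eqP.
- move=> h; have [b [hb _]] := pull_leading g.
  have := lc _ s; rewrite es => /(_ _ hb)[e _].
  have /eqP h0 := h s; rewrite h0 in e; by case: b hb e.
move=> h; have := lc false s1; rewrite es1 => /(_ leading_one)[_].
by have /eqP -> := h s1.
Qed.

Lemma Aut0E : @Aut0 K X = fun g => leads false (pull g).
Proof.
apply/funext => g; apply/propext; split.
  move=> H; apply: (H (fun g => leads false (pull g))).
  split=> [|h /family_leading//]; split.
  - exact: leading_one.
  - by move=> x y hx hy; have := leading_mul hx hy.
  - by move=> x; apply: leading_invg.
move=> h H [_ sub]; apply: sub.
have [b [hb [h1 _]]] := pull_leading g; apply: h1.
exact: (leading_inj nb_gt0 hb h).
Qed.

(** A symmetric cone makes the exchange an automorphism of type [true], which no family joins to the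
    identity; without the symmetry every automorphism has type [false]. *)
Lemma connected_sym : Aut_connected X <-> ~ (forall p q, S p q -> S q p).
Proof.
split=> [conn sym|nsym g].
  have [tau [tauK tauX]] := swap_exists iotaK iota_rhoX sym.
  have [g hg] := push_exists tauK tauK.
  have e : pull g =1 tau by move=> c; apply: points_separate => x; rewrite -pullE hg.
  have ltau : leads true (pull g).
    move=> p q Sp; exists 1; first exact: oner_neq0.
    have Sq := sym _ _ Sp.
    move=> p' q' _; rewrite e tauX // mul1r (cf_chi iota_rhoX) //.
    by rewrite xpair_eqE [p' == _]eq_sym [q' == _]eq_sym.
  by have := leading_inj nb_gt0 ltau (family_leading (conn g)).
have [[] [_ [h1 h2]]] := pull_leading g; last exact: h1.
by case: nsym; apply: h2.
Qed.

Lemma quotient_Z2 : ~ Aut_connected X -> quotient_isog (@Aut0 K X) 'Z_2.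
Proof.
move=> nconn.
have [t ht] : exists g : Aut X, leads true (pull g).
  apply: contrapT => H; apply: nconn => g.
  have [[] [hb [h1 _]]] := pull_leading g; last exact: h1.
  by case: H; exists g.
rewrite Aut0E; split.
  split; first split.
  - exact: leading_one.
  - by move=> x y hx hy; have := leading_mul hx hy.
  - by move=> x; apply: leading_invg.
  move=> g n hn; have [b [hb _]] := pull_leading g.
  have := leading_mul (leading_mul hb hn) (leading_invg hb).
  by rewrite addbF addbb.
(* The type, read off from a coset by looking for an element of type [true]. *)
pose phi (C : set (Aut X)) : 'Z_2 :=
  if `[< exists g, C g /\ leads true (pull g) >] then 1 else 0.
have phiE g b : leads b (pull g) ->
    phi (left_coset (fun h => leads false (pull h)) g) = if b then 1 else 0.
  move=> hg; rewrite /phi; case: asboolP => [[_ [[n hn ->] h]]|H].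
    have := leading_mul hg hn; rewrite addbF => h'.
    by rewrite (leading_inj nb_gt0 h' h).
  case: b hg => // hg; case: H; exists g; split=> //.
  by exists 1%g; [exact: leading_one | rewrite mulg1].
exists phi; split.
- move=> g h; have [b [hb _]] := pull_leading g; have [c [hc _]] := pull_leading h.
  rewrite (phiE _ _ (leading_mul hb hc)) (phiE _ _ hb) (phiE _ _ hc).
  by case: b c {hb hc} => -[]; apply: val_inj.
- move=> g h; have [b [hb _]] := pull_leading g; have [c [hc _]] := pull_leading h.
  rewrite (phiE _ _ hb) (phiE _ _ hc) => e.
  have ebc : b = c by case: b c e {hb hc} => -[].
  subst c; apply/funext => x; apply/propext; split=> -[n hn ->].
    exists (h^-1 * g * n)%g; last by rewrite !mulgA mulgV mul1g.
    by have := leading_mul (leading_mul (leading_invg hc) hb) hn; rewrite addbb.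
  exists (g^-1 * h * n)%g; last by rewrite !mulgA mulgV mul1g.
  by have := leading_mul (leading_mul (leading_invg hb) hc) hn; rewrite addbb.
move=> z; case: (boolP (z == 0)) => [/eqP->|z0].
  by exists 1%g; rewrite (phiE _ _ leading_one).
exists t; rewrite (phiE _ _ ht); apply: val_inj.
by case: z z0 => -[|[|]].
Qed.

End AutomorphismComponents.

Theorem proposition3 (K : closedFieldType) (charK0 : [pchar K] =i pred0)
    (a b : int) (a_ge0 : 0 <= a) (a_lt_b : a < b) (ab_prim : coprimez a b) :
  let X := toric_surface a (le_lt_trans a_ge0 a_lt_b) K in
  (Aut_connected X <-> [\/ a = 1, b = 1 | (a ^+ 2 != 1 %[mod b])%Z]) /\
  (~ Aut_connected X -> quotient_isog (@Aut0 K X) 'Z_2).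
Proof.
move=> X; pose b_gt0 : 0 < b := le_lt_trans a_ge0 a_lt_b.
have char0 n : n.+1%:R != 0 :> K by have /pcharf0P -> := charK0.
pose na := `|a|%N; pose nb := `|b|%N.
have ea : a = na%:Z by rewrite gez0_abs.
have eb : b = nb%:Z by rewrite gtz0_abs.
have nb_gt0 : (0 < nb)%N by rewrite absz_gt0 gt_eqF.
have na_lt : (na < nb)%N by rewrite -ltz_nat -ea -eb.
have na_le := ltnW na_lt.
have EK := @embedK K a b b_gt0 a_ge0.
have ER := @embed_reynoldsX K a b b_gt0 a_ge0.
have [small|big] := boolP ((na == 1%N) || (nb == 1%N)).
  have conn : Aut_connected X.
    exact: (small_connected char0 nb_gt0 na_le ab_prim EK ER small).
  split=> //; split=> // _.
  by case/orP: small => /eqP e; [constructor 1|constructor 2]; rewrite ?ea ?eb e.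
have {big} na_bounds : (1 < na < nb)%N.
  rewrite na_lt andbT; case/norP: big => h1 h2.
  (* For [a = 0], coprimality would give [b = 1]. *)
  have : na != 0%N.
    have cop : coprime na nb := ab_prim.
    by apply/eqP => h0; move: cop; rewrite h0 /coprime gcd0n (negbTE h2).
  by lia.
split; last exact: (quotient_Z2 char0 nb_gt0 na_le ab_prim EK ER na_bounds).
apply: (iff_trans (connected_sym char0 nb_gt0 na_le ab_prim EK ER na_bounds)).
have sq : (a ^+ 2 == 1 %[mod b])%Z = (nb %| na ^ 2 - 1)%N.
  have na2 : (0 < na ^ 2)%N by rewrite expn_gt0; case/andP: na_bounds => h _; lia.
  have e : a ^+ 2 - 1 = (na ^ 2 - 1)%N%:Z by rewrite ea expr2 -PoszM -subzn ?mulnn.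
  by rewrite eqz_mod_dvd e dvdzE.
rewrite sq; have symP := in_cone_sym nb_gt0 na_le ab_prim na_bounds.
split=> [h|[e|e|h]].
- by constructor 3; apply/negP => /symP.
- by move: na_bounds; rewrite /na e.
- by move: na_bounds; rewrite /nb e; lia.
- by move/symP; apply/negP.
Qed.
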